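(* Let $0<q<1$ and let $G$ be a finite abelian group with a symmetric pairing $\langle\cdot,\cdot\rangle_{\hat G}$ on $\hat G=\mathrm{Hom}(G,\mathbb Q/\mathbb Z)$. Then there exist positive constants $c,K$ (depending on $G$ and $q$) such that for every $n$, if $\Gamma\in G(n,q)$ is a random graph with sandpile group $S$ and canonical symmetric pairing $\langle\cdot,\cdot\rangle_{\hat S}$ on $\hat S$, then \[\big|\mathbb E(\#\mathrm{Sur}^*(S,G))-|G|^{-1}\big|\le Ke^{-cn}.\]
   Context: $G(n,q)$: random simple graph on $\{1,\dots,n\}$ with each edge present independently with probability $q$. Laplacian $L$: $L_{ij}=1$ if $i\ne j$ adjacent, $0$ if $i\ne j$ nonadjacent, $L_{ii}=-\deg(i)$. $Z\subset\mathbb Z^n$: vectors with coordinate sum $0$; $S=Z/L\mathbb Z^n\subset\mathrm{cok}(L)=\mathbb Z^n/L\mathbb Z^n$. $\widehat{\mathrm{cok}(L)}$ consists of $\phi:\mathbb Z^n\to\mathbb Q/\mathbb Z$ with $\phi L=0$, with pairing $\langle x,y\rangle_L=XLY^t\bmod\mathbb Z$ for row-vector lifts $X,Y\in\mathbb Q^n$. The canonical pairing on $\hat S$: $\langle x,y\rangle_{\hat S}=\langle\tilde x,\tilde y\rangle_L$ for any $\tilde x,\tilde y\in\widehat{\mathrm{cok}(L)}$ restricting to $x,y$ on $S$ (well defined). $\mathrm{Sur}^*(S,G)$: surjective homomorphisms $F:S\to G$ with $\langle u\circ F,v\circ F\rangle_{\hat S}=\langle u,v\rangle_{\hat G}$ for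 all $u,v\in\hat G$. *)

(* Defs.v *)
From HB Require Import structures.
From mathcomp Require Import all_boot all_order all_algebra.
From mathcomp Require Import finmap.
From mathcomp Require Import all_classical reals.

Set Implicit Arguments.
Unset Strict Implicit.
Unset Printing Implicit Defensive.

Import Order.TTheory GRing.Theory Num.Theory.

Local Open Scope ring_scope.
Local Open Scope quotient_scope.
Local Open Scope classical_set_scope.

(* Q/Z: [Num.int_num_subdef] is the predicate underlying the qualifier [Num.int]. *)
Definition QZ := Quotient.quot (@Num.int_num_subdef rat : {pred rat}).
HB.instance Definition _ := ZmodQuotient.on QZ.

(* Hom(A, Q/Z). *)
Notation pdual A := {additive A -> QZ}.

Definition symmetric_pairing (A : zmodType) (b : pdual A -> pdual A -> QZ) : Prop :=
  [/\ forall u v : pdual A, b u v = b v u,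
      forall u v w : pdual A, b (u \+ v) w = b u w + b v w &
      forall u v w : pdual A, b u (v \+ w) = b u v + b u w].

(* A simple graph on 'I_n is its edge set, a set of two-element subsets of 'I_n. *)
Definition graph (n : nat) :=
  {E : {set {set 'I_n}} | [forall e in E, #|e| == 2%N]}.

Definition adj (n : nat) (g : graph n) (i j : 'I_n) : bool :=
  [set i; j]%SET \in val g.

Definition deg (n : nat) (g : graph n) (i : 'I_n) : nat :=
  #|[set j | adj g i j]%SET|.

Definition laplacian (n : nat) (g : graph n) : 'M[int]_n :=
  \matrix_(i, j) if i == j then - (deg g i)%:Z else (adj g i j)%:Z.

Definition zero_sum (n : nat) : {pred 'cV[int]_n} :=
  fun v => \sum_i v i 0 == 0.

Lemma zero_sum_zmod_closed (n : nat) : zmod_closed (@zero_sum n).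
Proof.
split=> [|u v]; rewrite !unfold_in.
  by rewrite big1 // => i _; rewrite mxE.
move=> /eqP u0 /eqP v0; under eq_bigr do rewrite !mxE.
by rewrite sumrB u0 v0 subrr.
Qed.

HB.instance Definition _ (n : nat) :=
  GRing.isZmodClosed.Build _ (@zero_sum n) (@zero_sum_zmod_closed n).

Record Zsum0 (n : nat) := MkZsum0 {
  vec_of : 'cV[int]_n;
  _ : vec_of \in @zero_sum n }.

HB.instance Definition _ (n : nat) := [isSub for @vec_of n].
HB.instance Definition _ (n : nat) := [Choice of Zsum0 n by <:].
HB.instance Definition _ (n : nat) := [SubChoice_isSubZmodule of Zsum0 n by <:].

(* The subgroup L Z^n of Z, where Z is [Zsum0 n]; all of L Z^n lies in Z by
   [laplacian_zero_sum]. *)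
Definition im_laplacian (n : nat) (g : graph n) : {pred Zsum0 n} :=
  fun z => `[< exists x : 'cV[int]_n, val z = laplacian g *m x >].

Lemma im_laplacian_zmod_closed (n : nat) (g : graph n) :
  zmod_closed (im_laplacian g).
Proof.
split=> [|y z]; rewrite !unfold_in.
  by apply/asboolP; exists 0; rewrite mulmx0 raddf0.
move=> /asboolP[a ya] /asboolP[b zb]; apply/asboolP; exists (a - b).
by rewrite mulmxBr -ya -zb raddfB.
Qed.

HB.instance Definition _ (n : nat) (g : graph n) :=
  GRing.isZmodClosed.Build _ (im_laplacian g) (im_laplacian_zmod_closed g).

Definition sandpile (n : nat) (g : graph n) :=
  Quotient.quot (im_laplacian g).
HB.instance Definition _ (n : nat) (g : graph n) :=
  ZmodQuotient.on (sandpile g).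

(* The dual of cok L = Z^n / L Z^n, seen as the phi : Z^n -> Q/Z with phi L = 0. *)
Definition cok_dual (n : nat) (L : 'M[int]_n) : set (pdual 'cV[int]_n) :=
  [set phi | forall v, phi (L *m v) = 0].

(* X is a row-vector lift of phi: phi is v |-> X v mod Z, see [is_liftE]. *)
Definition is_lift (n : nat) (phi : pdual 'cV[int]_n) (X : 'rV[rat]_n) : Prop :=
  forall i, phi (delta_mx i 0) = \pi_QZ (X 0 i).

(* X L Y^t mod Z for any lifts X, Y; lifts exist ([is_lift_repr]) and on
   [cok_dual L], for L symmetric, the value is independent of them
   ([cok_pairingE]). *)
Definition cok_pairing (n : nat) (L : 'M[int]_n) (phi psi : pdual 'cV[int]_n) : QZ :=
  xget 0 [set r | exists X Y : 'rV[rat]_n,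
    [/\ is_lift phi X, is_lift psi Y &
        r = \pi_QZ ((X *m map_mx intr L *m Y^T) 0 0)]].

Definition restricts_to (n : nat) (g : graph n) (phi : pdual 'cV[int]_n)
    (x : pdual (sandpile g)) : Prop :=
  forall z : Zsum0 n, x (\pi_(sandpile g) z) = phi (val z).

(* The value of [cok_pairing] on any extensions to cok L; extensions exist
   ([restricts_to_exists]) and the value is independent of them
   ([sandpile_pairingE]). *)
Definition sandpile_pairing (n : nat) (g : graph n) (x y : pdual (sandpile g)) : QZ :=
  xget 0 [set r | exists phi psi : pdual 'cV[int]_n,
    [/\ cok_dual (laplacian g) phi /\ restricts_to phi x,
        cok_dual (laplacian g) psi /\ restricts_to psi y &
        r = cok_pairing (laplacian g) phi psi]].

(* [{classic _}] only provides the choiceType structure needed to take the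
   cardinal of this set with [fset_set], which is faithful on finite sets: see
   [Sur_star_finite]. *)
Definition Sur_star (G : finZmodType) (b : pdual G -> pdual G -> QZ) (n : nat)
    (g : graph n) : set {classic {additive sandpile g -> G}} :=
  [set F : {additive sandpile g -> G} |
    (forall a : G, exists s, F s = a) /\
    (forall u v : pdual G, sandpile_pairing (u \o F) (v \o F) = b u v)].

Arguments Sur_star {G} b {n} g.

(* The law of G(n, q): a product of Bernoulli(q) laws over the pairs of vertices. *)
Definition Gnq_prob (R : realType) (q : R) (n : nat) (g : graph n) : R :=
  \prod_(e : {set 'I_n} | #|e| == 2%N) (if e \in val g then q else 1 - q).

Definition Gnq_expect (R : realType) (q : R) (n : nat) (f : graph n -> R) : R :=
  \sum_(g : graph n) Gnq_prob q g * f g.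

Lemma QZ_eqP (x y : rat) :
  reflect (\pi_QZ x = \pi_QZ y) (x - y \is a Num.int).
Proof.
apply: (iffP idP) => [h|/eqP h].
  by apply/eqP; rewrite -Quotient.idealrBE.
by have := h; rewrite -Quotient.idealrBE.
Qed.

Lemma dual_delta (n : nat) (phi : pdual 'cV[int]_n) (v : 'cV[int]_n) :
  phi v = \sum_i phi (delta_mx i 0) *~ v i 0.
Proof.
rewrite {1}[v]matrix_sum_delta raddf_sum; apply: eq_bigr => i _.
by rewrite big_ord1 -raddfMz -scaler_int intz.
Qed.

Lemma is_liftE (n : nat) (phi : pdual 'cV[int]_n) (X : 'rV[rat]_n) v :
  is_lift phi X -> phi v = \pi_QZ ((X *m map_mx intr v) 0 0).
Proof.
move=> hX; rewrite dual_delta mxE raddf_sum; apply: eq_bigr => i _.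
by rewrite hX !mxE mulrzr raddfMz.
Qed.

Lemma is_lift_repr (n : nat) (phi : pdual 'cV[int]_n) :
  is_lift phi (\row_i repr (phi (delta_mx i 0))).
Proof. by move=> i; rewrite mxE reprK. Qed.

Lemma laplacian_tr (n : nat) (g : graph n) : (laplacian g)^T = laplacian g.
Proof.
apply/matrixP => i j; rewrite !mxE eq_sym; case: eqP => [->//|_].
by rewrite /adj finset.setUC.
Qed.

Lemma adj_irr (n : nat) (g : graph n) i : adj g i i = false.
Proof.
apply/negP => h; have /forall_inP/(_ _ h) := valP g.
by rewrite finset.setUid cards1.
Qed.

Lemma laplacian_col_sum (n : nat) (g : graph n) j : \sum_i laplacian g i j = 0.
Proof.
have dE : deg g j = (\sum_(i | i != j) adj g i j)%N.
  rewrite /deg -sum1_card big_mkcond (bigD1 j) //= finset.in_set adj_irr add0n.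
  by apply: eq_bigr => i _; rewrite finset.in_set /adj finset.setUC; case: ifP.
rewrite (bigD1 j) //= mxE eqxx dE (big_morph Posz PoszD (erefl _)) addrC.
apply/eqP; rewrite subr_eq0; apply/eqP/eq_bigr => i /negPf ij.
by rewrite mxE ij.
Qed.

Lemma laplacian_zero_sum (n : nat) (g : graph n) (x : 'cV[int]_n) :
  laplacian g *m x \in @zero_sum n.
Proof.
rewrite unfold_in; under eq_bigr do rewrite mxE.
rewrite exchange_big /= big1 // => j _.
by rewrite -mulr_suml laplacian_col_sum mul0r.
Qed.

Lemma trmx11 (T : Type) (M : 'M[T]_1) : M 0 0 = M^T 0 0.
Proof. by rewrite mxE. Qed.

Lemma cok_dual_int (n : nat) (L : 'M[int]_n) phi X (v : 'rV[int]_n) :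
  cok_dual L phi -> is_lift phi X -> L^T = L ->
  (map_mx intr v *m map_mx intr L *m X^T) 0 0 \is a Num.int.
Proof.
move=> hphi hX sL; rewrite trmx11 !trmx_mul trmxK.
rewrite !map_trmx sL -map_mxM.
by have := hphi v^T; rewrite (is_liftE _ hX) -(raddf0 \pi_QZ) => /QZ_eqP; rewrite subr0.
Qed.

Lemma is_lift_diff (n : nat) (phi : pdual 'cV[int]_n) X X' :
  is_lift phi X -> is_lift phi X' -> exists v : 'rV[int]_n, X = X' + map_mx intr v.
Proof.
move=> hX hX'; exists (\row_i Num.floor (X 0 i - X' 0 i)).
apply/rowP => i; rewrite !mxE; have /QZ_eqP : \pi_QZ (X 0 i) = \pi_QZ (X' 0 i).
  by rewrite -hX -hX'.
by move=> /floorK ->; rewrite addrC subrK.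
Qed.

Lemma cok_pairingE (n : nat) (L : 'M[int]_n) phi psi X Y :
  L^T = L -> cok_dual L phi -> cok_dual L psi -> is_lift phi X -> is_lift psi Y ->
  cok_pairing L phi psi = \pi_QZ ((X *m map_mx intr L *m Y^T) 0 0).
Proof.
move=> sL cphi cpsi hX hY; apply: xget_unique; first by exists X, Y.
move=> _ [X' [Y' [hX' hY' ->]]]; apply/esym/QZ_eqP.
have [v ->] := is_lift_diff hX hX'; have [w Yw] := is_lift_diff hY hY'.
rewrite !mulmxDl mxE addrAC rpredD //; last exact: (cok_dual_int _ cpsi).
rewrite Yw raddfD /= mulmxDr mxE addrAC subrr add0r.
rewrite trmx11 !trmx_mul trmxK mulmxA.
by rewrite map_trmx sL; exact: (cok_dual_int _ cphi).
Qed.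

Lemma sum_delta (n : nat) (i : 'I_n) :
  \sum_k (delta_mx i 0 : 'cV[int]_n) k 0 = 1.
Proof.
rewrite (bigD1 i) //= mxE !eqxx big1 ?addr0// => k /negPf ki.
by rewrite mxE ki.
Qed.

Lemma Zsum0_gen (n : nat) (i j : 'I_n) :
  delta_mx i 0 - delta_mx j 0 \in @zero_sum n.
Proof.
rewrite unfold_in; under eq_bigr do rewrite mxE [X in _ + X]mxE.
by rewrite sumrB !sum_delta subrr.
Qed.

Lemma restricts_to_exists (n : nat) (g : graph n) (x : pdual (sandpile g)) :
  exists2 phi : pdual 'cV[int]_n, cok_dual (laplacian g) phi & restricts_to phi x.
Proof.
case: n g x => [|n] g x.
  exists (\0 : pdual 'cV[int]_0) => // z.
  have -> : z = 0 by apply: val_inj; apply/matrixP => -[].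
  by rewrite !raddf0.
have cP (v : 'cV[int]_n.+1) :
    v - (\sum_i v i 0) *: delta_mx 0 0 \in @zero_sum n.+1.
  rewrite unfold_in; under eq_bigr do rewrite 2!mxE [X in _ - X]mxE.
  by rewrite sumrB -mulr_sumr sum_delta mulr1 subrr.
pose c v : Zsum0 n.+1 := MkZsum0 (cP v).
have ca : zmod_morphism (fun v => x (\pi_(sandpile g) (c v))).
  move=> u v; rewrite -!raddfB; congr (x _); congr (\pi_(sandpile g) _).
  apply: val_inj; rewrite [RHS]raddfB /=.
  under [in LHS]eq_bigr do rewrite mxE [X in _ + X]mxE.
  by rewrite sumrB scalerBl !opprD addrACA opprK.
pose phi : pdual 'cV[int]_n.+1 := HB.pack (fun v => x (\pi_(sandpile g) (c v)))
  (GRing.isZmodMorphism.Build _ _ _ ca).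
exists phi => [v|z] /=.
  rewrite -(raddf0 x); congr (x _); apply/eqP.
  rewrite -(raddf0 \pi_(sandpile g)) -Quotient.idealrBE subr0 unfold_in.
  apply/asboolP; exists v => /=.
  by have /eqP -> := laplacian_zero_sum g v; rewrite scale0r subr0.
congr (x _); congr (\pi_(sandpile g) _); apply: val_inj => /=.
by have /eqP -> := valP z; rewrite scale0r subr0.
Qed.

Lemma restricts_to_diff (n : nat) (g : graph n) (x : pdual (sandpile g)) phi phi' X :
  restricts_to phi x -> restricts_to phi' x -> is_lift phi' X ->
  exists a : rat, is_lift phi (X + const_mx a).
Proof.
case: n g x phi phi' X => [|n] g x phi phi' X hp hp' hX; first by exists 0 => -[].
exists (repr (phi (delta_mx 0 0) - phi' (delta_mx 0 0))) => i.
rewrite !mxE raddfD /= reprK -hX.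
have := hp (MkZsum0 (Zsum0_gen i 0)); rewrite hp' /= !raddfB /= => h.
by rewrite addrCA h addrC subrK.
Qed.

Lemma sandpile_pairingE (n : nat) (g : graph n) (x y : pdual (sandpile g)) phi psi :
  cok_dual (laplacian g) phi -> restricts_to phi x ->
  cok_dual (laplacian g) psi -> restricts_to psi y ->
  sandpile_pairing x y = cok_pairing (laplacian g) phi psi.
Proof.
move=> cp hp cs hs; apply: xget_unique; first by exists phi, psi.
move=> _ [phi' [psi' [[cp' hp'] [cs' hs'] ->]]].
have hX := is_lift_repr phi; have hY := is_lift_repr psi.
have [a hX'] := restricts_to_diff hp' hp hX.
have [b hY'] := restricts_to_diff hs' hs hY.
have sL := laplacian_tr g.
rewrite (cok_pairingE sL cp cs hX hY) (cok_pairingE sL cp' cs' hX' hY').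
have cL c : const_mx c *m map_mx intr (laplacian g) = 0 :> 'rV[rat]_n.
  apply/rowP => j; rewrite !mxE.
  under eq_bigr do rewrite [X in X * _]mxE [X in _ * X]mxE.
  rewrite -mulr_sumr; have := laplacian_col_sum g j.
  by move=> /(congr1 (intr : int -> rat)); rewrite rmorph_sum /= => ->; rewrite mulr0.
have cLr c : map_mx intr (laplacian g) *m (const_mx c : 'rV[rat]_n)^T = 0.
  by rewrite -[LHS]trmxK trmx_mul trmxK map_trmx sL cL trmx0.
by rewrite mulmxDl cL addr0 [in LHS]raddfD /= mulmxDr -[X in _ + X]mulmxA cLr mulmx0 addr0.
Qed.

Lemma Sur_star_finite (G : finZmodType) b (n : nat) (g : graph n) :
  finite_set (@Sur_star G b n g).
Proof.
pose h (F : {classic {additive sandpile g -> G}}) : {ffun 'I_n * 'I_n -> G} :=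
  [ffun p => (F : {additive sandpile g -> G})
     (\pi_(sandpile g) (MkZsum0 (Zsum0_gen p.1 p.2)))].
have h_inj : injective h.
  move=> F F' hFF'.
  have FF' : forall s, (F : {additive _ -> _}) s = (F' : {additive _ -> _}) s.
    move=> s; rewrite -[s]reprK; move: (repr s) => z.
    case: (pickP (fun _ : 'I_n => true)) => [i _|n0]; last first.
      have -> : z = 0 by apply: val_inj; apply/matrixP => k; have := n0 k.
      by rewrite !raddf0.
    have -> : z = \sum_k MkZsum0 (Zsum0_gen k i) *~ val z k 0.
      apply: val_inj; rewrite raddf_sum.
      under eq_bigr do rewrite raddfMz /= mulrzBl.
      rewrite sumrB -mulrz_sumr; have /eqP -> := valP z.
      rewrite mulr0z subr0 [LHS]matrix_sum_delta; apply: eq_bigr => k _.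
      by rewrite big_ord1 -scaler_int intz.
    rewrite !raddf_sum; apply: eq_bigr => k _; rewrite !raddfMz; congr (_ *~ _).
    by have /ffunP/(_ (k, i)) := hFF'; rewrite !ffunE.
  case: F F' FF' {hFF'} => [F [[F1]]] [F' [[F1']]] /= /funext FF'.
  case: _ / FF' in F1' *.
  by have -> : F1 = F1' by exact: Prop_irrelevance.
apply: (@sub_finite_set _ _ (h @^-1` setT)) => //.
by apply: finite_preimage => [F F' _ _ /h_inj//|]; exact: finite_finset.
Qed.

Lemma Gnq_prob_sum1 (R : realType) (q : R) (n : nat) :
  \sum_(g : graph n) Gnq_prob q g = 1.
Proof.
pose F (e : {set 'I_n}) : R := if #|e| == 2%N then q else 0.
pose H (e : {set 'I_n}) : R := if #|e| == 2%N then 1 - q else 1.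
have -> : 1 = \prod_e (F e + H e) :> R.
  rewrite big1 // => e _; rewrite /F /H.
  by case: ifP; rewrite ?add0r// addrC subrK.
rewrite bigA_distr (bigID (fun J : {set {set 'I_n}} =>
  [forall e in J, #|e| == 2%N])) /= [X in _ + X]big1 ?addr0; last first.
  move=> J /forall_inPn[e eJ e2].
  by rewrite (bigD1 e) //= eJ /F (negPf e2) mul0r.
rewrite (reindex_omap val (insub : _ -> option (graph n))) /=; last first.
  by move=> J hJ; rewrite insubT.
apply: eq_big => [g|g _]; first by rewrite valK eqxx andbT (valP g).
rewrite /Gnq_prob big_mkcond; apply: eq_bigr => e _; rewrite /F /H.
case: ifPn => [//|e2]; case: ifP => // eg.
by have /forall_inP/(_ _ eg) := valP g; rewrite (negPf e2).
Qed.

(* Main.v *)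
(* Write G as a sum of cyclic groups of orders a_k (k < r), let N be a common
   multiple of the a_k a_l, and let V0 = (Z/N)^r, which maps onto G.  A
   surjection S -> G extends in #|G| ways to a labelling f of the vertices by
   elements of G; the conditions defining Sur^* become linear congruences on the
   Laplacian once f is lifted to V0.  Detecting them by characters of Z/N brings
   in a dual label c_i in V0 at each vertex and a quadratic form QQ, and the
   expectation becomes an average over QQ of partition functions
     sum_v prod_(i < j) (1 - q + q psi (- Q (v_i - v_j))),
   with v_i = (x_i, c_i) in V = V0 * V0 and Q (x, c) = x QQ x^T - <c, x>.
   A factor is 1 if Q (v_i - v_j) = 0 and otherwise has modulus at most rho < 1, so
   up to an exponentially small relative error only the labellings with all
   values in a clique of maximal size M = #|V| / #|G| matter, and each such clique
   contributes M ^ n.  Maximal cliques are cosets of maximal isotropic subgroups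
   of V; those mapping onto G are the graphs of bilinear maps s with
   Q (x, s x) = 0, and these can be counted on average over QQ. *)

Require Import Defs.
From HB Require Import structures.
From mathcomp Require Import all_classical reals sequences exp.
From mathcomp Require Import finmap complex.
From mathcomp Require Import all_boot all_order all_algebra.
From mathcomp Require Import all_fingroup abelian cyclic separable cyclotomic.
From mathcomp Require Import ring lra zify.

Set Implicit Arguments.
Unset Strict Implicit.
Unset Printing Implicit Defensive.

Import Order.TTheory GRing.Theory Num.Theory.

Local Open Scope ring_scope.

(** * Partition functions dominated by cliques *)

(** The Laplacian is minus the sum of (e_i - e_j)(e_i - e_j)^T over the edges. Hence a character of
    its entries factors over the edges once its coefficients are the values of one bilinear form at
    the vertex labels; this is why all conditions are packed into a single form on V, and why only Q
    (v_i - v_j) survives. The modulus N must see a_k a_l, and not only a_k, because X L Y^t has that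
    denominator when X and Y have denominators a_k and a_l. The pairing on the dual of G enters only
    through a root of unity attached to QQ. That factor is 1 whenever some s satisfies Q (x, s x) =
    0, since the numerators of the pairing are divisible by a_k and by a_l. The main term is
    therefore a plain count of pairs (QQ, s), the same for every pairing. The obstacle is the prime
    2: Q is not determined by its polar form, so isotropy always refers to Q itself and quadratic
    forms are represented by upper triangular matrices. For the error, a labelling with two popular
    values in conflict pays a factor of order rho to the n^2, which beats the number of all
    labellings; near a clique of maximal size each stray vertex pays a factor exponentially small in
    n. *)

Lemma big_lt_neq (T : Type) (idx : T) (op : Monoid.com_law idx) n (F : 'I_n -> 'I_n -> T) :
  \big[op/idx]_(i < n) \big[op/idx]_(j < n | (i < j)%N) op (F i j) (F j i) =
  \big[op/idx]_(i < n) \big[op/idx]_(j < n | j != i) F i j.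
Proof.
under eq_bigr => i _ do rewrite big_split /=.
rewrite big_split /= [X in op _ X](exchange_big_dep predT) //= -big_split /=.
apply: eq_bigr => i _; rewrite [RHS](bigID (fun j : 'I_n => (i < j)%N)) /=.
congr (op _ _); apply: eq_bigl => j; rewrite -val_eqE /=; case: ltngtP => //.
Qed.

Section Cliques.
Variables (C : numFieldType) (V : finType) (ok : rel V) (w : V -> V -> C) (rho : C).
Hypothesis ok_sym : symmetric ok.
Hypothesis ok_refl : reflexive ok.
Hypothesis rho_ge0 : 0 <= rho.
Hypothesis rho_le1 : rho <= 1.
Hypothesis w_ok : forall a b, ok a b -> w a b = 1.
Hypothesis w_bad : forall a b, ~~ ok a b -> `|w a b| <= rho.

Definition weight n (v : {ffun 'I_n -> V}) : C :=
  \prod_(i < n) \prod_(j < n | (i < j)%N) w (v i) (v j).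

Definition clique (T : {set V}) := [forall a in T, forall b in T, ok a b].

Lemma cliqueP (T : {set V}) : reflect {in T &, forall a b, ok a b} (clique T).
Proof.
apply: (iffP forall_inP) => h a; first by move=> b /h/forall_inP; apply.
by move=> aT; apply/forall_inP => b; apply: h.
Qed.

Definition outside n (A : {set V}) (v : {ffun 'I_n -> V}) :=
  #|[set i | v i \notin A]|.

(** Each bad pair joining a vertex outside A to a vertex inside A is charged to its outer endpoint.
    No pair is charged twice, so the losses of the outer vertices multiply. *)
Lemma weight_le n (v : {ffun 'I_n -> V}) (A : {set V}) (d : nat) :
  (forall i, v i \notin A ->
     (d <= #|[set j | (v j \in A) && ~~ ok (v i) (v j)]|)%N) ->
  `|weight v| <= rho ^+ (d * outside A v).
Proof.
move=> hd; pose r i j : C :=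
  if [&& v i \notin A, v j \in A & ~~ ok (v i) (v j)] then rho else 1.
have r_ge0 i j : 0 <= r i j by rewrite /r; case: ifP.
have r_le1 i j : r i j <= 1 by rewrite /r; case: ifP.
have -> : `|weight v| = \prod_(i < n) \prod_(j < n | (i < j)%N) `|w (v i) (v j)|.
  by rewrite /weight normr_prod; apply: eq_bigr => i _; rewrite normr_prod.
(* At most one of [r i j] and [r j i] differs from 1: the first needs [v i] outside A, the second
   needs it inside. *)
apply: (@le_trans _ _ (\prod_(i < n) \prod_(j < n | (i < j)%N) (r i j * r j i))).
  apply: ler_prod => i _; rewrite prodr_ge0 //=.
  apply: ler_prod => j _; rewrite normr_ge0 /=.
  have [vok|/w_bad le_rho] := boolP (ok (v i) (v j)).
    by rewrite w_ok // normr1 /r vok ok_sym vok !andbF mulr1.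
  apply: le_trans le_rho _; rewrite /r.
  by case: (v i \in A); case: (v j \in A) => //=; rewrite ?(mul1r, mulr1) //; case: ifP.
rewrite big_lt_neq.
have -> : rho ^+ (d * outside A v) = \prod_i (if v i \notin A then rho ^+ d else 1).
  rewrite -big_mkcond /= prodr_const exprM /outside; congr (_ ^+ _).
  by apply: eq_card => i; rewrite !inE.
apply: ler_prod => i _; rewrite prodr_ge0 //=.
case: ifPn => [vi|_]; last by apply: prodr_ile1 => j; rewrite r_ge0 r_le1.
rewrite (bigID (fun j => (v j \in A) && ~~ ok (v i) (v j))) /=.
rewrite -[leRHS]mulr1; apply: ler_pM => //; try exact: prodr_ge0; last first.
  by apply: prodr_ile1 => j; rewrite r_ge0 r_le1.
rewrite (eq_bigl (mem [set j | (v j \in A) && ~~ ok (v i) (v j)])); last first.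
  move=> j; rewrite !inE; case: eqP => [->|//]; by rewrite ok_refl andbF.
rewrite (eq_bigr (fun=> rho)) => [|j]; last by rewrite /= inE => jP; rewrite /r vi jP.
by rewrite prodr_const; apply: ler_wiXn2l => //; exact: hd.
Qed.

Definition popular m n (v : {ffun 'I_n -> V}) : {set V} :=
  [set a | (m < #|[set i | v i == a]|)%N].

Lemma outside_popular m n (v : {ffun 'I_n -> V}) :
  (outside (popular m v) v <= #|V| * m)%N.
Proof.
rewrite /outside -sum1_card (partition_big v predT) //=.
have -> : (#|V| * m = \sum_(a : V) m)%N by rewrite sum_nat_const.
apply: leq_sum => a _; rewrite sum1_card.
have [aP|aP] := boolP (a \in popular m v).
  rewrite (eq_card0 _) // => i; rewrite unfold_in /= inE.
  by apply/negP => /andP[/negP h /eqP vi]; apply: h; rewrite vi.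
move: aP; rewrite inE -leqNgt; apply: leq_trans; apply: subset_leq_card.
by apply/fintype.subsetP => i; rewrite unfold_in !inE => /andP[].
Qed.

Lemma popular_image m n (v : {ffun 'I_n -> V}) a :
  a \in popular m v -> exists i, v i = a.
Proof.
rewrite inE => h; have /card_gt0P[k] := leq_ltn_trans (leq0n _) h.
by rewrite inE => /eqP; exists k.
Qed.

(** For a conflicting popular pair a, b, take A to be the complement of a: each of the more than m
    vertices labelled a is in conflict with each of the more than m vertices labelled b. *)
Lemma weight_popular_bad m n (v : {ffun 'I_n -> V}) :
  ~~ clique (popular m v) -> `|weight v| <= rho ^+ (m.+1 ^ 2).
Proof.
case/forall_inPn => a aP /forall_inPn [b bP bad].
have out : outside (~: [set a]) v = #|[set i | v i == a]|.
  by apply: eq_card => i; rewrite !inE negbK.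
move: aP bP; rewrite !inE => aP bP.
apply: le_trans (weight_le (A := ~: [set a]) (d := m.+1) _) _ => [i|].
  rewrite !inE negbK => /eqP ->; apply: leq_trans bP _.
  apply: subset_leq_card; apply/fintype.subsetP => j; rewrite !inE => /eqP ->.
  by rewrite bad andbT; apply: contraNneq bad => ->.
apply: ler_wiXn2l => //; rewrite out expnS expn1 leq_mul2l; exact: aP.
Qed.

Lemma sum_ffun_pow (A : {set V}) (t : C) n :
  \sum_(v : {ffun 'I_n -> V}) t ^+ outside A v
  = (#|A|%:R + (#|V| - #|A|)%:R * t) ^+ n.
Proof.
have -> : #|A|%:R + (#|V| - #|A|)%:R * t = \sum_(a : V) (if a \notin A then t else 1).
  rewrite (bigID (mem A)) /=; congr (_ + _).
    rewrite (eq_bigr (fun=> 1)) => [|a ->//]; by rewrite sumr_const.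
  rewrite (eq_bigr (fun=> t)) => [|a ->//].
  rewrite sumr_const mulr_natl; congr (_ *+ _).
  by rewrite -(cardC A) addKn; apply: eq_card => a; rewrite !inE.
rewrite -[n in RHS]card_ord -prodr_const bigA_distr_bigA /=; apply: eq_bigr => v _.
rewrite -big_mkcond /= prodr_const; congr (_ ^+ _).
by apply: eq_card => i; rewrite !inE.
Qed.

(** Exponential Markov inequality: every labelling counted has D ^ (k - outside) at least 1. The
    base D = 2 (#|V| + 1) makes all the values outside A together contribute at most 1/2 per vertex,
    and #|A| + 1/2 is at most M - 1/2. *)
Lemma card_few_outside (A : {set V}) (k M n : nat) : (#|A| < M)%N ->
  #|[set v : {ffun 'I_n -> V} | (outside A v <= k)%N]|%:R
   <= ((#|V|.+1).*2)%:R ^+ k * (M%:R - 2^-1) ^+ n :> C.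
Proof.
move=> AM; set D := (#|V|.+1).*2; have D0 : 0 < D%:R :> C by rewrite ltr0n.
have D1 : 1 <= D%:R :> C by rewrite ler1n.
apply: (@le_trans _ _ (D%:R ^+ k * \sum_(v : {ffun 'I_n -> V}) D%:R^-1 ^+ outside A v)).
  rewrite -sum1_card natr_sum mulr_sumr big_mkcond /=; apply: ler_sum => v _.
  rewrite inE; case: ifP => [le_k|_]; last by rewrite mulr_ge0 ?exprn_ge0 ?invr_ge0 // ltW.
  rewrite -(subnK le_k) exprD -mulrA -exprMn divff ?gt_eqF // expr1n mulr1.
  exact: exprn_ege1.
rewrite ler_wpM2l ?exprn_ge0 ?(ltW D0) // sum_ffun_pow.
have l0 : 0 <= #|A|%:R + (#|V| - #|A|)%:R * D%:R^-1 :> C.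
  by rewrite addr_ge0 ?mulr_ge0 ?invr_ge0 // ltW.
have h2 : (#|V| - #|A|)%:R / D%:R <= 2^-1 :> C.
  rewrite ler_pdivrMr // /D -muln2 natrM [_ * 2]mulrC mulrA mulVf ?pnatr_eq0 // mul1r ler_nat.
  by rewrite (leq_trans (leq_subr _ _)) // leqnSn.
suff le : #|A|%:R + (#|V| - #|A|)%:R * D%:R^-1 <= M%:R - 2^-1 :> C.
  by rewrite lerXn2r // ?nnegrE // (le_trans l0).
rewrite lerBrDr -addrA; apply: (@le_trans _ _ (#|A|%:R + (2^-1 + 2^-1))).
  by rewrite lerD2l lerD2r.
have -> : 2^-1 + 2^-1 = 1 :> C by rewrite [RHS](splitr 1) mul1r.
by rewrite natr1 ler_nat.
Qed.

Variables (P : {set V} -> bool) (M : nat).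
Hypothesis clique_le : forall T, clique T -> (#|T| <= M)%N.

Definition top_cliques := [set T : {set V} | [&& clique T, #|T| == M & P T]].

Definition image_of n (v : {ffun 'I_n -> V}) : {set V} := [set v i | i in 'I_n].

(* Compare with the set T of popular values of v: if T is not a clique the weight
   is tiny, few labellings have a small T, and if T is a clique of size M then by
   maximality every value outside T is bad for some popular value. *)
Lemma top_clique_summand m n (v : {ffun 'I_n -> V}) :
  `|(P (image_of v))%:R * weight v
     - #|[set T in top_cliques | outside T v == 0%N]|%:R|
  <= rho ^+ (m.+1 ^ 2)
   + (1 + (2 ^ #|V|)%:R) *
       \sum_(S : {set V} | (#|S| < M)%N) (outside S v <= #|V| * m)%N%:R
   + \sum_(S : {set V} | #|S| == M) (rho ^+ m.+1 ^+ outside S v - (outside S v == 0%N)%:R).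
Proof.
have e1 : 0 <= rho ^+ (m.+1 ^ 2) by exact: exprn_ge0.
have e2 : 0 <= (1 + (2 ^ #|V|)%:R) *
   \sum_(S : {set V} | (#|S| < M)%N) (outside S v <= #|V| * m)%N%:R :> C.
  by rewrite mulr_ge0 ?addr_ge0 ?sumr_ge0.
have e3S (S : {set V}) : 0 <= rho ^+ m.+1 ^+ outside S v - (outside S v == 0%N)%:R.
  by case: eqP => [->|_]; rewrite ?expr0 ?subrr // subr0 !exprn_ge0.
have e3 : 0 <= \sum_(S : {set V} | #|S| == M)
    (rho ^+ m.+1 ^+ outside S v - (outside S v == 0%N)%:R) by exact: sumr_ge0.
have Pw : `|(P (image_of v))%:R * weight v| <= `|weight v|.
  by case: (P _); rewrite ?mul1r // mul0r normr0.
have inT (T : {set V}) : outside T v = 0%N -> forall i, v i \in T.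
  move=> /eqP; rewrite cards_eq0 => /eqP h i; apply/negPn/negP => vi.
  by have := in_set0 i; rewrite -h inE vi.
have subT (T : {set V}) : outside T v = 0%N -> popular m v \subset T.
  by move=> /inT h; apply/fintype.subsetP => a /popular_image[k <-].
have [cl|bad] := boolP (clique (popular m v)); last first.
  rewrite (_ : [set T in _ | _] = set0) ?cards0 ?subr0; last first.
    apply/eqP/set0Pn => -[T]; rewrite !inE => /andP[/and3P[clT _ _] /eqP /subT sT].
    case/negP: bad; apply/cliqueP => a b /(fintype.subsetP sT) aT /(fintype.subsetP sT).
    by move: a b aT; apply/cliqueP.
  rewrite (le_trans Pw) // (le_trans (weight_popular_bad bad)) // -addrA lerDl.
  by rewrite addr_ge0.
have := clique_le cl; rewrite leq_eqVlt => /predU1P[cardM|ltM]; last first.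
  (* A crude bound suffices here, because few labellings have a small popular set: the weight has
     modulus at most 1 and there are at most 2 ^ #|V| top cliques. *)
  apply: (@le_trans _ _ (1 + (2 ^ #|V|)%:R)).
    rewrite (le_trans (ler_normB _ _)) // lerD //.
      apply: le_trans Pw _.
      by apply: le_trans (weight_le (A := setT) (d := 0) _) _ => //; rewrite mul0n expr0.
    rewrite normr_nat ler_nat (leq_trans (max_card _)) //.
    by rewrite -[#|V|]cardsT -card_powerset powersetT cardsT.
  rewrite -addrA -[leLHS]add0r lerD // -[leLHS]addr0 lerD // -[leLHS]mulr1.
  rewrite ler_wpM2l ?addr_ge0 // (bigD1 (popular m v)) //= outside_popular.
  by rewrite lerDl sumr_ge0.
have [out0|out] := eqVneq (outside (popular m v) v) 0%N.
  suff -> : (P (image_of v))%:R * weight v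
     - #|[set T in top_cliques | outside T v == 0%N]|%:R = 0.
    by rewrite normr0 !addr_ge0.
  have imE : image_of v = popular m v.
    apply/setP => a; apply/imsetP/idP => [[k _ ->]|/popular_image[k <-]]; first exact: inT.
    by exists k.
  have -> : weight v = 1.
    apply: big1 => i _; apply: big1 => j _; apply: w_ok.
    by apply: (cliqueP _ cl); exact: inT.
  rewrite imE mulr1; apply/eqP; rewrite subr_eq0; apply/eqP.
  rewrite (_ : [set T in _ | _] = if P (popular m v) then [set popular m v] else set0).
    by case: ifP; rewrite ?cards1 ?cards0.
  apply/setP => T; rewrite !inE; apply/idP/idP => [|].
    move=> /andP[/and3P[_ /eqP cT PT] /eqP/subT sT].
    have {}sT : popular m v = T by apply/eqP; rewrite eqEcard sT cT cardM leqnn.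
    by rewrite sT PT inE.
  by case: ifP; rewrite !inE // => PP /eqP ->; rewrite cl cardM eqxx PP out0 eqxx.
(* A top clique containing all values of v would contain the popular set, hence equal it by size,
   which the stray vertex forbids. *)
rewrite (_ : [set T in _ | _] = set0) ?cards0 ?subr0; last first.
  apply/eqP/set0Pn => -[T]; rewrite !inE => /andP[/and3P[_ /eqP cT _] out0].
  have TE : popular m v = T.
    by apply/eqP; rewrite eqEcard cT cardM leqnn andbT; apply: subT; exact/eqP.
  by rewrite TE out0 in out.
rewrite (le_trans Pw) // -[leLHS]add0r lerD ?addr_ge0 //.
rewrite (bigD1 (popular m v)) /=; last exact/eqP.
rewrite (negPf out) subr0 -[leLHS]addr0 lerD ?sumr_ge0 // -exprM.
apply: weight_le => i vi.
have [a aP bad] : exists2 a, a \in popular m v & ~~ ok (v i) a.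
  apply/exists_inP; apply: contraT; rewrite negb_exists_in => /forall_inP allok.
  have /clique_le : clique (v i |: popular m v).
    apply/cliqueP => a b; rewrite !in_setU1 => /predU1P[->|aP] /predU1P[->|bP] //.
    - by have := allok _ bP; rewrite negbK.
    - by rewrite ok_sym; have := allok _ aP; rewrite negbK.
    - exact: (cliqueP _ cl).
  by rewrite cardsU1 vi cardM add1n ltnn.
have aP' := aP; rewrite inE in aP'; apply: leq_trans aP' _.
apply: subset_leq_card; apply/fintype.subsetP => j; rewrite [in X in X -> _]inE => /eqP vj.
by rewrite [in X in is_true X]inE vj aP bad.
Qed.

(** A top clique contains the values of M ^ n labellings, which gives the main term. The three
    errors come from popular sets that are not cliques, from cliques with fewer than M elements, and
    from stray vertices around a clique of size M. Labellings shared by several top cliques are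
    counted once for each; their popular set is too small, so the second error pays for them. *)
Lemma top_clique_sum m n : (0 < M)%N ->
  `|\sum_(v : {ffun 'I_n -> V}) (P (image_of v))%:R * weight v
     - #|top_cliques|%:R * M%:R ^+ n|
  <= #|V|%:R ^+ n * rho ^+ (m.+1 ^ 2)
   + (1 + (2 ^ #|V|)%:R) *
       ((2 ^ #|V|)%:R * (((#|V|.+1).*2)%:R ^+ (#|V| * m) * (M%:R - 2^-1) ^+ n))
   + (2 ^ #|V|)%:R * ((M%:R + #|V|%:R * rho ^+ m.+1) ^+ n - M%:R ^+ n).
Proof.
move=> M0; have cardS : #|{set V}| = (2 ^ #|V|)%N.
  by rewrite -[#|V|]cardsT -card_powerset powersetT cardsT.
have pow0 (S : {set V}) : \sum_(v : {ffun 'I_n -> V}) (outside S v == 0%N)%:R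
    = #|S|%:R ^+ n :> C.
  rewrite -[#|S|%:R]addr0 -[X in _ + X](mulr0 (#|V| - #|S|)%:R) -sum_ffun_pow.
  by apply: eq_bigr => v _; rewrite expr0n.
have -> : #|top_cliques|%:R * M%:R ^+ n = \sum_(v : {ffun 'I_n -> V})
    #|[set T in top_cliques | outside T v == 0%N]|%:R :> C.
  have E (v : {ffun 'I_n -> V}) : #|[set T in top_cliques | outside T v == 0%N]|%:R
      = \sum_(T in top_cliques) (outside T v == 0%N)%:R :> C.
    rewrite -sum1_card natr_sum big_mkcond /= [RHS]big_mkcond.
    by apply: eq_bigr => T _; rewrite [in LHS]inE; case: (T \in _) => //=; case: eqP.
  under [RHS]eq_bigr => v _ do rewrite E.
  rewrite exchange_big /= (eq_bigr (fun=> M%:R ^+ n)) ?sumr_const ?mulr_natl //.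
  by move=> T; rewrite inE pow0 => /and3P[_ /eqP ->].
rewrite -sumrB (le_trans (ler_norm_sum _ _ _)) //.
apply: le_trans (ler_sum _ (fun v _ => top_clique_summand m v)) _.
rewrite !big_split /= -mulr_sumr lerD ?lerD //.
- by rewrite sumr_const card_ffun card_ord -natrX mulr_natl.
- rewrite ler_wpM2l ?addr_ge0 // exchange_big /= -cardS mulr_natl -sumr_const.
  rewrite [leLHS]big_mkcond /=; apply: ler_sum => S _; case: ifP => [SM|_].
    apply: le_trans (card_few_outside _ _ SM); rewrite -[#|_| in leRHS]sum1_card natr_sum.
    by rewrite [leRHS]big_mkcond; apply: ler_sum => v _; rewrite inE; case: ifP.
  rewrite mulr_ge0 ?exprn_ge0 // subr_ge0 (@le_trans _ _ 1) ?ler1n //.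
  by rewrite invf_le1 ?ler1n // ltr0n.
- rewrite exchange_big /= -cardS mulr_natl -sumr_const.
  have pos : 0 <= #|V|%:R * rho ^+ m.+1 by rewrite mulr_ge0 ?exprn_ge0.
  rewrite [leLHS]big_mkcond /=; apply: ler_sum => S _; case: ifP => [/eqP SM|_]; last first.
    by rewrite subr_ge0 lerXn2r ?nnegrE ?addr_ge0 // lerDl.
  rewrite sumrB sum_ffun_pow pow0 SM lerD2r lerXn2r ?nnegrE ?addr_ge0 ?mulr_ge0 ?exprn_ge0 //.
  by rewrite lerD2l ler_wpM2r ?exprn_ge0 // ler_nat leq_subr.
Qed.

End Cliques.

(** * Exponentially small sequences *)

Lemma bernoulli (R : realFieldType) (y : R) n : -1 <= y -> 1 + n%:R * y <= (1 + y) ^+ n.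
Proof.
move=> y1; elim: n => [|n IHn]; first by rewrite mul0r addr0 expr0.
rewrite exprS; have y10 : 0 <= 1 + y by lra.
apply: le_trans (ler_wpM2l y10 IHn); rewrite -natr1.
have := sqr_ge0 y; have : 0 <= n%:R :> R by [].
nra.
Qed.

(** By Bernoulli's inequality it is enough to take r = 1 - h with k h at most 1 - rho. This turns
    bounds in rho ^ (n / k) into bounds in r ^ n. *)
Lemma root_lt1 (R : realFieldType) (rho : R) k : 0 <= rho -> rho < 1 ->
  exists r, [/\ 0 < r, r < 1 & rho <= r ^+ k].
Proof.
move=> rho0 rho1; pose h := (1 - rho) / (2 * k.+1%:R).
have k1 : 1 <= k.+1%:R :> R by rewrite ler1n.
have hE : h * (2 * k.+1%:R) = 1 - rho by rewrite /h divfK // mulf_neq0 ?pnatr_eq0.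
have h0 : 0 < h by apply: divr_gt0; lra.
exists (1 - h); split; [nra | lra |].
have h1 : -1 <= - h by nra.
apply: le_trans (bernoulli k h1); rewrite -natr1 in hE k1 *; nra.
Qed.

Lemma pow_lt_eventually (R : archiRealFieldType) (r e : R) : 0 < r -> r < 1 -> 0 < e ->
  exists m, r ^+ m <= e.
Proof.
move=> r0 r1 e0; pose y := r^-1 - 1.
have y0 : 0 < y by rewrite subr_gt0 invf_gt1.
have [m hm] : exists m, (e * y)^-1 <= m%:R.
  by exists (Num.bound (e * y)^-1); apply/ltW/archi_boundP; rewrite invr_ge0 mulr_ge0 ?ltW.
exists m; have y1 : -1 <= y by lra.
have := bernoulli m y1; rewrite [1 + y]addrC subrK exprVn => hB.
have rm : 0 < r ^+ m by rewrite exprn_gt0.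
rewrite -[e]invrK -[leLHS]invrK lef_pV2 ?posrE ?invr_gt0 //.
apply: le_trans hB; have : (e * y)^-1 * y <= m%:R * y by rewrite ler_wpM2r // ltW.
by rewrite invfM -mulrA mulVf ?gt_eqF // mulr1; lra.
Qed.

Section ExpSmall.
Variable R : realType.

(** Only an upper bound, meant for nonnegative sequences. A ratio t is easier to combine than an
    exponential rate; [exp_small_expR] converts at the end. *)
Definition exp_small (u : nat -> R) :=
  exists t K, [/\ 0 < t, t < 1, 0 <= K & forall n, u n <= K * t ^+ n].

Lemma exp_small_eventually n0 u :
  (exists t K, [/\ 0 < t, t < 1, 0 <= K & forall n, (n0 <= n)%N -> u n <= K * t ^+ n]) ->
  exp_small u.
Proof.
case=> t [K [t0 t1 K0 h]]; exists t, (K + \sum_(i < n0) `|u i| / t ^+ i).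
have s0 (i : 'I_n0) : 0 <= `|u i| / t ^+ i by rewrite divr_ge0 // exprn_ge0 // ltW.
split=> //; first by rewrite addr_ge0 // sumr_ge0.
move=> n; have tn : 0 < t ^+ n by rewrite exprn_gt0.
rewrite mulrDl; case: (leqP n0 n) => [/h le|lt].
  by apply: le_trans le _; rewrite lerDl mulr_ge0 ?sumr_ge0 // ltW.
rewrite -[leLHS]add0r lerD ?mulr_ge0 ?(ltW tn) // (bigD1 (Ordinal lt)) //= mulrDl.
rewrite -[leLHS]addr0 lerD //; last by rewrite mulr_ge0 ?sumr_ge0 // ltW.
by rewrite divfK ?gt_eqF // ler_norm.
Qed.

Lemma exp_smallD u v : exp_small u -> exp_small v -> exp_small (fun n => u n + v n).
Proof.
case=> t [K [t0 t1 K0 h]] [t' [K' [t0' t1' K0' h']]].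
exists (Num.max t t'), (K + K'); split.
- by rewrite lt_max t0.
- by rewrite gt_max t1.
- exact: addr_ge0.
move=> n; rewrite mulrDl; apply: lerD.
  apply: le_trans (h n) _; rewrite ler_wpM2l // lerXn2r ?nnegrE ?le_max ?(ltW t0) ?lexx //.
apply: le_trans (h' n) _; rewrite ler_wpM2l // lerXn2r ?nnegrE ?le_max ?(ltW t0') ?lexx ?orbT //.
Qed.

Lemma exp_smallZ a u : 0 <= a -> exp_small u -> exp_small (fun n => a * u n).
Proof.
move=> a0 [t [K [t0 t1 K0 h]]]; exists t, (a * K); split=> //; first exact: mulr_ge0.
by move=> n; rewrite -mulrA ler_wpM2l.
Qed.

Lemma exp_small_expR u : exp_small u ->
  exists c K, [/\ 0 < c, 0 < K & forall n, u n <= K * expR (- c * n%:R)].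
Proof.
case=> t [K [t0 t1 K0 h]]; exists (- ln t), (K + 1); split.
- by rewrite oppr_gt0 ln_lt0 // t0.
- by rewrite ltr_wpDl.
move=> n; rewrite opprK mulrC [_ * n%:R]mulrC expRM_natl lnK ?posrE //.
apply: le_trans (h n) _; rewrite [leRHS]mulrC ler_wpM2r ?exprn_ge0 ?(ltW t0) //.
by rewrite lerDl.
Qed.

Lemma expR_sub1_le (z : R) : expR z - 1 <= z * expR z.
Proof.
have h : (1 - z) * expR z <= 1.
  rewrite -[leRHS](expRxMexpNx_1 z) mulrC ler_wpM2l ?expR_ge0 //.
  by have := expR_ge1Dx (- z).
lra.
Qed.

(** With y = x r ^ n, the quantity is at most exp (n y) - 1, hence at most n y exp (n y). The factor
    n is absorbed by giving up half of the rate: r is at most s ^ 2, and n s ^ n stays bounded. *)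
Lemma exp_small_perturb (x r : R) : 0 <= x -> 0 < r -> r < 1 ->
  exp_small (fun n => (1 + x * r ^+ n) ^+ n - 1).
Proof.
move=> x0 r0 r1; have [s [s0 s1 rs]] := root_lt1 2 (ltW r0) r1.
pose h := s^-1 - 1; have h0 : 0 < h by rewrite subr_gt0 invf_gt1.
have ns n : n%:R * s ^+ n <= h^-1.
  rewrite -ler_pdivlMr ?exprn_gt0 // -exprVn mulrC ler_pdivlMr //.
  have h1 : -1 <= h by lra.
  by have := bernoulli n h1; rewrite (_ : 1 + h = s^-1) 1?addrC ?subrK //; lra.
pose A := x / h; have A0 : 0 <= A by rewrite divr_ge0 // ltW.
exists s, (A * expR A); split=> //; first by rewrite mulr_ge0 // expR_ge0.
move=> n; pose y := x * r ^+ n.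
have y0 : 0 <= y by rewrite mulr_ge0 // exprn_ge0 // ltW.
have sn : 0 <= s ^+ n by rewrite exprn_ge0 // ltW.
have nyA : n%:R * y <= A * s ^+ n.
  have : y <= x * (s ^+ n * s ^+ n).
    rewrite ler_wpM2l // -exprD addnn -mul2n exprM lerXn2r ?nnegrE ?(ltW r0) //.
    by rewrite exprn_ge0 // ltW.
  move=> /(ler_wpM2l (ler0n R n)) /le_trans; apply.
  rewrite mulrCA [X in x * X]mulrA mulrA ler_wpM2r //.
  by rewrite /A ler_wpM2l.
have s1' : s ^+ n <= 1 by rewrite exprn_ile1 // ltW.
apply: (@le_trans _ _ (expR (n%:R * y) - 1)).
  rewrite lerD2r expRM_natl lerXn2r ?nnegrE ?expR_ge0 ?addr_ge0 //.
  exact: expR_ge1Dx.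
apply: le_trans (expR_sub1_le _) _.
rewrite [leRHS]mulrAC; apply: ler_pM; rewrite ?(mulr_ge0 (ler0n _ _) y0) ?expR_ge0 //.
by rewrite ler_expR (le_trans nyA) // ler_piMr.
Qed.

(** The right-hand side of [top_clique_sum] with v = #|V|, over the reals; the clique estimate
    itself is used over the complex numbers. *)
Definition clique_error (rho : R) (v M m n : nat) : R :=
  v%:R ^+ n * rho ^+ (m.+1 ^ 2)
   + (1 + (2 ^ v)%:R) *
       ((2 ^ v)%:R * ((v.+1.*2)%:R ^+ (v * m) * (M%:R - 2^-1) ^+ n))
   + (2 ^ v)%:R * ((M%:R + v%:R * rho ^+ m.+1) ^+ n - M%:R ^+ n).

(** The threshold m has to be linear in n, so that rho ^ m is exponentially small, but with a slope
    1 / k so small that the entropy factor (2 (v + 1)) ^ (v m) does not compensate the gain of (M -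
    1/2) ^ n over M ^ n. *)
Lemma clique_error_exp_small (rho : R) (v M : nat) : 0 <= rho -> rho < 1 -> (0 < M)%N ->
  exists m : nat -> nat, exp_small (fun n => clique_error rho v M (m n) n / M%:R ^+ n).
Proof.
move=> rho0 rho1 M0; have M1 : 1 <= M%:R :> R by rewrite ler1n.
have M0' : 0 < M%:R :> R by lra.
(* The entropy factor is D ^ m. With eta = 1 / (4 M), (M - 1/2) / M is 1 - 2 eta and (1 + eta)(1 - 2
   eta) < 1; the value of k gives (1 + eta) ^ k >= 1 + k eta > D. *)
pose D := (v.+1.*2 ^ v)%N; pose k := (4 * M * D)%N.
have k0 : (0 < k)%N by rewrite !muln_gt0 M0 expn_gt0 double_gt0.
pose eta : R := (4 * M%:R)^-1.
have etaE : eta * (4 * M%:R) = 1 by rewrite mulVf //; lra.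
have eta0 : 0 < eta by rewrite invr_gt0; lra.
have kD : D%:R <= (1 + eta) ^+ k.
  have e1 : -1 <= eta by lra.
  apply: le_trans (bernoulli k e1).
  by rewrite /k !natrM [_ * eta]mulrC mulrA etaE mul1r lerDr.
have [r [r0 r1 rk]] := root_lt1 k rho0 rho1.
have rn i : 0 < r ^+ i by rewrite exprn_gt0.
exists (fun n => n %/ k)%N.
have rho_r n : rho ^+ (n %/ k).+1 <= r ^+ n.
  apply: (@le_trans _ _ ((r ^+ k) ^+ (n %/ k).+1)).
    by rewrite lerXn2r // ?nnegrE // ltW.
  by rewrite -exprM ler_wiXn2l ?ltW // mulnC ltnW // ltn_ceil.
have Mn n : 0 < M%:R ^+ n :> R by rewrite exprn_gt0.
(* The exponent (m + 1) ^ 2 is quadratic in n: the term is at most (v / M * r ^ (m + 1)) ^ n, whose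
   base falls below 1/2 once n is large. *)
have T1 : exp_small (fun n => v%:R ^+ n * rho ^+ ((n %/ k).+1 ^ 2) / M%:R ^+ n).
  have e0 : 0 < M%:R / (2 * v.+1%:R) :> R by rewrite divr_gt0 // mulr_gt0.
  have [m hm] := pow_lt_eventually r0 r1 e0.
  apply: (exp_small_eventually (n0 := (k * m)%N)); exists 2^-1, 1; split=> //; try lra.
  move=> n n_ge; rewrite mul1r expnS expn1 exprM.
  apply: (@le_trans _ _ ((v%:R / M%:R * r ^+ (n %/ k).+1) ^+ n)).
    rewrite [leRHS]exprMn expr_div_n [leLHS]mulrAC ler_wpM2l ?divr_ge0 ?exprn_ge0 ?(ltW M0') //.
    by rewrite [leRHS]exprAC lerXn2r ?nnegrE ?exprn_ge0 // ltW.
  rewrite lerXn2r ?nnegrE ?mulr_ge0 ?invr_ge0 ?(ltW (rn _)) ?(ltW M0') //.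
  have le1 : r ^+ (n %/ k).+1 <= M%:R / (2 * v.+1%:R).
    apply: le_trans hm; rewrite ler_wiXn2l ?(ltW r0) ?(ltW r1) //.
    by rewrite (leq_trans _ (leqnSn _)) // leq_divRL // mulnC.
  apply: (@le_trans _ _ (v%:R / M%:R * (M%:R / (2 * v.+1%:R)))).
    by rewrite ler_wpM2l // divr_ge0 // ltW.
  rewrite mulrA divfK ?gt_eqF // ler_pdivrMr ?mulr_gt0 // mulrA mulVf ?pnatr_eq0 // mul1r.
  by rewrite ler_nat.
have T2 : exp_small (fun n => (v.+1.*2)%:R ^+ (v * (n %/ k)) * (M%:R - 2^-1) ^+ n / M%:R ^+ n).
  exists ((1 + eta) * (1 - eta * 2)), 1; split=> //; try nra.
  move=> n; rewrite mul1r -mulrA -expr_div_n [leRHS]exprMn.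
  have -> : (M%:R - 2^-1) / M%:R = 1 - eta * 2.
    rewrite mulrBl divff ?gt_eqF //; congr (_ - _); rewrite /eta invfM; field; lra.
  rewrite ler_wpM2r ?exprn_ge0 //; first nra.
  rewrite exprM -natrX -/D; apply: (@le_trans _ _ (((1 + eta) ^+ k) ^+ (n %/ k))).
    by rewrite lerXn2r ?nnegrE // (le_trans _ kD).
  rewrite -exprM; apply: ler_weXn2l; first lra.
  by rewrite mulnC leq_trunc_div.
have T3 : exp_small (fun n =>
    ((M%:R + v%:R * rho ^+ (n %/ k).+1) ^+ n - M%:R ^+ n) / M%:R ^+ n).
  have x0 : 0 <= v%:R / M%:R :> R by rewrite divr_ge0 // ltW.
  have [t [K [t0 t1 K0 h]]] := exp_small_perturb x0 r0 r1.
  exists t, K; split=> // n; apply: le_trans (h n).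
  rewrite mulrBl divff ?gt_eqF // lerD2r -expr_div_n.
  rewrite mulrDl divff ?gt_eqF // lerXn2r ?nnegrE ?addr_ge0 ?mulr_ge0 ?exprn_ge0
    ?invr_ge0 ?(ltW r0) ?(ltW M0') //.
  by rewrite lerD2l mulrAC ler_wpM2l.
have c2 : 0 <= (1 + (2 ^ v)%:R) * (2 ^ v)%:R :> R by rewrite mulr_ge0 ?addr_ge0.
have [t [K [t0 t1 K0 h]]] := exp_smallD (exp_smallD T1 (exp_smallZ c2 T2))
   (exp_smallZ (ler0n R (2 ^ v)) T3).
exists t, K; split=> // n; apply: le_trans (h n).
by rewrite /clique_error 2![in leLHS](mulrDl _ _ (M%:R ^+ n)^-1) !mulrA.
Qed.

End ExpSmall.

(** * Characters and the law of G(n, q) *)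

Lemma prim_root_exists (F : numClosedFieldType) n : (0 < n)%N ->
  exists z : F, n.-primitive_root z.
Proof.
move=> n0; have [rs rsE] := closed_field_poly_normal ('X^n - 1 : {poly F}).
rewrite (monicP _) ?monicXnsubC // scale1r in rsE.
have unity : all n.-unity_root rs by apply/allP => z; rewrite -root_prod_XsubC -rsE.
have rs_uniq : uniq rs.
  by rewrite -separable_prod_XsubC -rsE separable_Xn_sub_1 // pnatr_eq0 -lt0n.
have size_rs : (n <= size rs)%N.
  by rewrite -ltnS -(size_prod_XsubC rs id) -rsE size_XnsubC.
by have /hasP[z _] := has_prim_root n0 unity rs_uniq size_rs; exists z.
Qed.

Lemma char_sum (C : idomainType) (A : finZmodType) (X : {set A}) (chi : A -> C) :
  zmod_closed X -> {in X &, forall a b, chi (a + b) = chi a * chi b} -> chi 0 = 1 ->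
  \sum_(x in X) chi x = if [forall x in X, chi x == 1] then #|X|%:R else 0.
Proof.
move=> [X0 XB] chiD chi0; have XN x : x \in X -> - x \in X.
  by move=> xX; rewrite -[- x]add0r XB.
case: ifPn => [/forall_inP h|/forall_inPn[x0 x0X chi1]].
  by rewrite (eq_bigr (fun=> 1)) ?sumr_const // => x /h/eqP.
apply/eqP; suff : (chi x0 - 1) * \sum_(x in X) chi x == 0.
  by rewrite mulf_eq0 subr_eq0 (negPf chi1).
rewrite mulrBl mul1r subr_eq0 mulr_sumr; apply/eqP.
rewrite [RHS](reindex_inj (addrI x0)) /=; apply: eq_big => [x|x xX]; last by rewrite chiD.
apply/idP/idP => [xX|h]; first by rewrite -[x]opprK XB ?XN.
by rewrite -[x](addKr x0) addrC XB.
Qed.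

Lemma set2_lt_inj n (p p' : 'I_n * 'I_n) : (p.1 < p.2)%N -> (p'.1 < p'.2)%N ->
  [set p.1; p.2] = [set p'.1; p'.2] -> p = p'.
Proof.
case: p p' => i j [k l] /= ij kl /setP hE.
have := hE i; have := hE j; have := hE k; have := hE l; rewrite !inE !eqxx ?orbT /=.
rewrite -!val_eqE /= => h1 h2 h3 h4; congr (_, _); apply/val_inj => /=; lia.
Qed.

Lemma prod_two_sets (C : comNzSemiRingType) n (F : {set 'I_n} -> C) :
  \prod_(e : {set 'I_n} | #|e| == 2%N) F e =
  \prod_(i < n) \prod_(j < n | (i < j)%N) F [set i; j].
Proof.
pose A := [set p : 'I_n * 'I_n | (p.1 < p.2)%N]; pose h (p : 'I_n * 'I_n) := [set p.1; p.2].
rewrite pair_big_dep /= (eq_bigl (mem A)) => [|p]; last by rewrite /= inE.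
have h_inj : {in A &, injective h} by move=> p p'; rewrite !inE; exact: set2_lt_inj.
rewrite -(big_imset _ h_inj) /=; apply: eq_bigl => e.
apply/idP/imsetP => [/cards2P[i [j [ij ->]]]|[[i j]]]; last first.
  rewrite inE /= => ij ->; rewrite cards2 /=.
  by suff -> : i != j by []; apply: contraTneq ij => ->; rewrite ltnn.
case: (ltngtP i j) => [lt|lt|/val_inj eij]; last by rewrite eij eqxx in ij.
  by exists (i, j); rewrite ?inE.
by exists (j, i); rewrite ?inE //= setUC.
Qed.

Lemma sum_graph_prod (C : comNzRingType) n (F H : {set 'I_n} -> C) :
  \sum_(g : graph n) \prod_(e : {set 'I_n} | #|e| == 2%N) (if e \in val g then F e else H e)
  = \prod_(e : {set 'I_n} | #|e| == 2%N) (F e + H e).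
Proof.
(* The values 0 and 1 off the two-element sets allow the product to be expanded over all families of
   subsets: those that are not graphs contribute 0. *)
pose F' (e : {set 'I_n}) : C := if #|e| == 2%N then F e else 0.
pose H' (e : {set 'I_n}) : C := if #|e| == 2%N then H e else 1.
have -> : \prod_(e : {set 'I_n} | #|e| == 2%N) (F e + H e) = \prod_e (F' e + H' e).
  rewrite big_mkcond; apply: eq_bigr => e _; rewrite /F' /H'.
  by case: ifP; rewrite ?add0r.
rewrite bigA_distr (bigID (fun J : {set {set 'I_n}} => [forall e in J, #|e| == 2%N])) /=.
rewrite [X in _ + X]big1 ?addr0; last first.
  by move=> J /forall_inPn[e eJ e2]; rewrite (bigD1 e) //= eJ /F' (negPf e2) mul0r.
rewrite [RHS](reindex_omap val (insub : _ -> option (graph n))) /=; last first.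
  by move=> J hJ; rewrite insubT.
apply: eq_big => [g|g _]; first by rewrite valK eqxx andbT (valP g).
rewrite big_mkcond; apply: eq_bigr => e _; rewrite /F' /H'.
case: ifPn => [//|e2]; case: ifP => // eg.
by have /forall_inP/(_ _ eg) := valP g; rewrite (negPf e2).
Qed.

Section Complex.
Variable R : realType.
Local Notation "x %:C" := (real_complex R x).

Lemma Gnq_expect_prod (q : R) n (y : 'I_n -> 'I_n -> R[i]) :
  \sum_(g : graph n) (Gnq_prob q g)%:C *
     \prod_(i < n) \prod_(j < n | (i < j)%N) (if adj g i j then y i j else 1)
  = \prod_(i < n) \prod_(j < n | (i < j)%N) (q%:C * y i j + (1 - q)%:C).
Proof.
(* Edges are unordered while [y] is only used for i < j, so the value is read at the increasing
   enumeration of e; the default 1 is never reached on an edge. *)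
pose Y (e : {set 'I_n}) : R[i] :=
  if [pick p : 'I_n * 'I_n | (p.1 < p.2)%N && (e == [set p.1; p.2])] is Some p
  then y p.1 p.2 else 1.
have YE (i j : 'I_n) : (i < j)%N -> Y [set i; j] = y i j.
  move=> ij; rewrite /Y; case: pickP => [p /andP[p12 /eqP pE]|/(_ (i, j))]; last first.
    by rewrite /= ij eqxx.
  by rewrite -(set2_lt_inj (p := (i, j)) ij p12 pE).
have E (F G : 'I_n -> 'I_n -> R[i]) : (forall i j : 'I_n, (i < j)%N -> F i j = G i j) ->
    \prod_(i < n) \prod_(j < n | (i < j)%N) F i j =
    \prod_(i < n) \prod_(j < n | (i < j)%N) G i j.
  by move=> h; apply: eq_bigr => i _; apply: eq_bigr => j; exact: h.
rewrite (E _ (fun i j => q%:C * Y [set i; j] + (1 - q)%:C)) => [|i j /YE -> //].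
rewrite -(prod_two_sets (fun e => q%:C * Y e + (1 - q)%:C)) -sum_graph_prod.
apply: eq_bigr => g _.
rewrite (E _ (fun i j => if [set i; j] \in val g then Y [set i; j] else 1)); last first.
  by move=> i j ij; rewrite YE.
rewrite -(prod_two_sets (fun e => if e \in val g then Y e else 1)).
rewrite rmorph_prod -big_split /=; apply: eq_bigr => e _.
by case: ifP; rewrite ?mulr1.
Qed.

(** Strict convexity of the disc: the squared modulus is 1 - 2 q (1 - q) (1 - Re u), and Re u < 1
    for a point u of the unit circle other than 1. *)
Lemma norm_convex_lt1 (q : R) (u : R[i]) : 0 < q -> q < 1 -> `|u| = 1 -> u != 1 ->
  `|q%:C * u + (1 - q)%:C| < 1.
Proof.
move=> q0 q1 u1 un1.
have : `|q%:C * u + (1 - q)%:C| ^+ 2 < 1.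
  rewrite -add_Re2_Im2; have := add_Re2_Im2 u; rewrite u1 expr1n.
  case: u un1 {u1} => a b; rewrite eq_complex /= => ab /eqP; rewrite eq_complex /=.
  rewrite eqxx andbT => /eqP ab1; rewrite ltcR !(mul0r, mulr0, subr0, addr0).
  have b0 : 0 <= b ^+ 2 by exact: sqr_ge0.
  have a1 : a < 1.
    rewrite lt_neqAle; apply/andP; split; last by nra.
    apply: contraNneq ab => a1; rewrite a1 eqxx /=; apply/eqP.
    move: ab1; rewrite a1 expr1n => h; apply/eqP; rewrite -sqrf_eq0; apply/eqP; lra.
  have : 0 < q * (1 - q) * (1 - a) by rewrite !mulr_gt0 //; lra.
  nra.
by rewrite expr_lt1.
Qed.

End Complex.

(** * Cliques of a quadratic form *)

Lemma maxset_clique_subP (V : finType) (ok : rel V) (T : {set V}) (c : V) :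
  symmetric ok -> reflexive ok -> maxset (clique ok) T ->
  (forall t, t \in T -> ok c t) -> c \in T.
Proof.
move=> ok_sym ok_refl /maxsetP[/cliqueP clT maxT] okc.
rewrite -(maxT (c |: T)) ?setU11 ?subsetUr //; apply/cliqueP => a b.
rewrite !in_setU1 => /predU1P[->|aT] /predU1P[->|bT] //; last exact: clT.
  exact: okc.
by rewrite ok_sym; exact: okc.
Qed.

Lemma sub_mxE (A : zmodType) m n (X Y : 'M[A]_(m, n)) i j : (X - Y) i j = X i j - Y i j.
Proof. by rewrite !mxE. Qed.

Section MetricModule.
Variables (N r : nat) (C : numFieldType) (psi : 'Z_N -> C).
Hypothesis psiD : forall a b, psi (a + b) = psi a * psi b.
Hypothesis psi_eq1 : forall a, psi a = 1 -> a = 0.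
Hypothesis psi0 : psi 0 = 1.
Variables (d : 'rV['Z_N]_r) (G : finZmodType) (pr : {additive 'rV['Z_N]_r -> G}).
Hypothesis pr_ker : forall x, (pr x == 0) = (x *m diag_mx d == 0).
Hypothesis pr_surj : forall g, exists x, pr x = g.
Variable QQ : 'M['Z_N]_r.

Local Notation V0 := 'rV['Z_N]_r.
Local Notation V := (V0 * V0)%type.
Local Notation D := (diag_mx d).

(** As [pr] is onto and its kernel consists of the x with x D = 0, this descends to a nondegenerate
    symmetric pairing on G with values in Z/N. *)
Definition dpair (c x : V0) : 'Z_N := (c *m D *m x^T) 0 0.
Definition rad : {set V0} := [set x | x *m D == 0].
(** A bilinear form with Q on its diagonal. It is not symmetric, and cannot be replaced by the polar
    form, because 2 need not be invertible modulo N. *)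
Definition bform (u v : V) : 'Z_N := (u.1 *m QQ *m v.1^T) 0 0 - dpair v.2 u.1.
Definition qform (v : V) : 'Z_N := bform v v.
Definition qok (u v : V) : bool := qform (u - v) == 0.
Definition qpolar u v := bform u v + bform v u.

Lemma dpairC c x : dpair c x = dpair x c.
Proof. by rewrite /dpair trmx11 !trmx_mul trmxK tr_diag_mx mulmxA. Qed.

Lemma dpairBl c c' x : dpair (c - c') x = dpair c x - dpair c' x.
Proof. by rewrite /dpair !mulmxBl !mxE. Qed.

Lemma dpairBr c x x' : dpair c (x - x') = dpair c x - dpair c x'.
Proof. by rewrite dpairC dpairBl !(dpairC c). Qed.

Lemma dpairDr c x x' : dpair c (x + x') = dpair c x + dpair c x'.
Proof. by rewrite /dpair raddfD mulmxDr mxE. Qed.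

Lemma dpair0r c : dpair c 0 = 0.
Proof. by rewrite -[X in dpair c X](subrr 0) dpairBr subrr. Qed.

Lemma dpairNr c x : dpair c (- x) = - dpair c x.
Proof. by rewrite -[- x]sub0r dpairBr dpair0r sub0r. Qed.

Lemma dpair_rad c x : c \in rad -> dpair c x = 0.
Proof. by rewrite inE /dpair => /eqP ->; rewrite mul0mx mxE. Qed.

Lemma dpair_delta c k : dpair c (delta_mx 0 k) = (c *m D) 0 k.
Proof.
rewrite /dpair trmx_delta mxE (bigD1 k) //= big1 ?addr0 => [|j /negPf jk].
  by rewrite [delta_mx _ _ _ _]mxE !eqxx mulr1.
by rewrite [delta_mx _ _ _ _]mxE jk mulr0.
Qed.

Lemma radP c : reflect (forall x, dpair c x = 0) (c \in rad).
Proof.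
apply: (iffP idP) => [cR x|h]; first exact: dpair_rad.
by rewrite inE; apply/eqP/rowP => k; rewrite -dpair_delta h mxE.
Qed.

Lemma rad_zmod_closed : zmod_closed rad.
Proof.
split=> [|x y]; rewrite !inE ?mul0mx // => /eqP hx /eqP hy.
by rewrite mulmxBl hx hy subrr.
Qed.

Lemma bformBl u v w : bform (u - v) w = bform u w - bform v w.
Proof.
by rewrite /bform /= dpairBr !mulmxBl sub_mxE; ring.
Qed.

Lemma bformBr u v w : bform u (v - w) = bform u v - bform u w.
Proof.
by rewrite /bform /= dpairBl raddfB /= mulmxBr sub_mxE; ring.
Qed.

Lemma qformB u v : qform (u - v) = qform u + qform v - qpolar u v.
Proof.
rewrite /qform bformBl !bformBr /qpolar.
by move: (bform u u) (bform u v) (bform v u) (bform v v) => a b c e; ring.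
Qed.

Lemma qpolarBl u v w : qpolar (u - v) w = qpolar u w - qpolar v w.
Proof.
rewrite /qpolar bformBl bformBr.
by move: (bform u w) (bform v w) (bform w u) (bform w v) => a b c e; ring.
Qed.

Lemma bform0l v : bform 0 v = 0.
Proof. by rewrite -[X in bform X _](subrr (0 : V)) bformBl subrr. Qed.

Lemma bform0r v : bform v 0 = 0.
Proof. by rewrite -[X in bform _ X](subrr (0 : V)) bformBr subrr. Qed.

Lemma qform0 : qform 0 = 0.
Proof. exact: bform0l. Qed.

Lemma qformN v : qform (- v) = qform v.
Proof. by rewrite -[- v]sub0r qformB qform0 /qpolar bform0l bform0r; ring. Qed.

Lemma qok_sym : symmetric qok.
Proof. by move=> u v; rewrite /qok -qformN opprB. Qed.

Lemma qok_refl : reflexive qok.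
Proof. by move=> u; rewrite /qok subrr qform0. Qed.

Lemma qok_shift u v w : qok (u - w) (v - w) = qok u v.
Proof. by rewrite /qok; congr (qform _ == 0); rewrite opprB addrA subrK. Qed.

Lemma qpolar0 c (v : V) : qpolar (0, c) v = - dpair c v.1.
Proof.
by rewrite /qpolar /bform /= dpair0r !mul0mx trmx0 mulmx0 !mxE; ring.
Qed.

Lemma qform0c c : qform (0, c) = 0.
Proof. by rewrite /qform /bform /= dpair0r !mul0mx mxE subr0. Qed.

(* On a clique containing 0 both Q and its polar form vanish, so adding a
   difference of two members preserves the clique property. *)
Lemma maxclique_closed (T : {set V}) : maxset (clique qok) T -> 0 \in T ->
  zmod_closed T /\ {in T, forall v, qform v = 0}.
Proof.
move=> mT T0; have /maxsetP[/cliqueP clT _] := mT.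
have q0 v : v \in T -> qform v = 0.
  by move=> vT; have /eqP := clT _ _ vT T0; rewrite subr0.
have p0 u v : u \in T -> v \in T -> qpolar u v = 0.
  move=> uT vT; have /eqP := clT _ _ uT vT; rewrite qformB !q0 // add0r sub0r.
  by move/eqP; rewrite oppr_eq0 => /eqP.
split=> //; split=> // u v uT vT.
apply: (maxset_clique_subP qok_sym qok_refl mT) => t tT.
rewrite /qok qformB qpolarBl !p0 // (q0 t) // qformB !q0 // p0 //.
by apply/eqP; ring.
Qed.

(** * Isotropic subgroups and the size of cliques *)

Definition proj1 (H : {set V}) : {set V0} := [set v.1 | v in H].
Definition perp (X : {set V0}) : {set V0} := [set c | [forall x in X, dpair c x == 0]].

Lemma proj1_zmod_closed (H : {set V}) : zmod_closed H -> zmod_closed (proj1 H).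
Proof.
case=> H0 HB; split; first by apply/imsetP; exists 0.
move=> _ _ /imsetP[u uH ->] /imsetP[v vH ->]; apply/imsetP; exists (u - v) => //.
exact: HB.
Qed.

Lemma psi_dpair_sum (X : {set V0}) c : zmod_closed X ->
  \sum_(x in X) psi (dpair c x) = if c \in perp X then #|X|%:R else 0.
Proof.
move=> Xz; rewrite (char_sum Xz) => [|a b _ _|]; last by rewrite dpair0r.
  congr (if _ then _ else _); rewrite inE; apply: eq_forallb_in => x _.
  by apply/eqP/eqP => [/psi_eq1|->].
by rewrite dpairDr psiD.
Qed.

Lemma perp_setT : perp setT = rad.
Proof.
apply/setP => c; rewrite inE; apply/forall_inP/radP => [h x|h x _]; last by rewrite h.
by apply/eqP/h; rewrite inE.
Qed.

(* Both sides are the sum of psi (dpair c x) over all c and all x in X. *)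
Lemma card_perp (X : {set V0}) : zmod_closed X ->
  (#|X| * #|perp X| = #|V0| * #|X :&: rad|)%N.
Proof.
move=> Xz; apply/eqP; rewrite -(eqr_nat C) !natrM; apply/eqP.
have VT : zmod_closed [set: V0] by split=> [|? ? ? ?]; rewrite inE.
transitivity (\sum_c \sum_(x in X) psi (dpair c x)).
  under eq_bigr => c _ do rewrite (psi_dpair_sum c Xz).
  by rewrite -big_mkcond sumr_const /= mulr_natr.
rewrite exchange_big /=.
transitivity (\sum_(x in X) if x \in rad then #|V0|%:R else 0 : C).
  apply: eq_bigr => x _; rewrite -perp_setT -[#|V0|]cardsT -psi_dpair_sum //.
  by apply: eq_big => [c|c _]; rewrite ?inE // dpairC.
rewrite -big_mkcondr sumr_const /= mulr_natr; congr (_ *+ _).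
by apply: eq_card => x; rewrite in_setI.
Qed.

(** Two elements of H over the same x differ by some (0, c) in H. Its polar form against w in H is -
    <c, w.1>, which vanishes by isotropy, so each fibre of the projection embeds in the orthogonal
    of [proj1 H]. *)
Lemma isotropic_card (H : {set V}) : zmod_closed H -> {in H, forall v, qform v = 0} ->
  (#|H| <= #|proj1 H| * #|perp (proj1 H)|)%N.
Proof.
move=> [H0 HB] q0; rewrite -sum1_card (partition_big (fun v => v.1) (mem (proj1 H))) /=.
  rewrite -sum_nat_const; apply: leq_sum => x _.
  rewrite sum1_card (@eq_card _ _ (mem [set v in H | v.1 == x])); last first.
    by move=> v; rewrite inE.
  have [->|[v0]] := set_0Vmem [set v in H | v.1 == x].
    by rewrite cards0.
  rewrite inE => /andP[v0H /eqP v0x].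
  have inj : {in [set v in H | v.1 == x] &, injective (fun v : V => v.2 - v0.2)}.
    move=> [a b] [a' b']; rewrite !inE /= => /andP[_ /eqP ->] /andP[_ /eqP ->].
    by move/addIr => ->.
  rewrite -(card_in_imset inj); apply: subset_leq_card; apply/fintype.subsetP => _ /imsetP[v vH ->].
  rewrite inE in vH; case/andP: vH => vH /eqP vx.
  rewrite inE; apply/forall_inP => _ /imsetP[w wH ->].
  have vv0 : v - v0 = (0, v.2 - v0.2).
    by rewrite [LHS]surjective_pairing /= vx v0x subrr.
  have := qformB (v - v0) w; rewrite !q0 ?HB // add0r vv0 qpolar0 opprK add0r.
  by move=> <-.
by move=> v vH; apply: imset_f.
Qed.

(** The size M in the form given by [card_perp]: with X the projection, #|X| * #|perp X| is #|V0| *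
    #|X :&: rad|, which is largest when X contains the radical. *)
Definition clique_bound := (#|V0| * #|rad|)%N.

(* Named because V has no finZmodType instance from which [set t - w | t in T]
   could be elaborated. *)
Definition trans (w t : V) : V := t - w.

Lemma clique_shift (T : {set V}) w : clique qok T -> clique qok (trans w @: T).
Proof.
move=> /cliqueP cl; apply/cliqueP => _ _ /imsetP[u uT ->] /imsetP[v vT ->].
by rewrite /trans qok_shift; exact: cl.
Qed.

Lemma card_shift (T : {set V}) w : #|trans w @: T| = #|T|.
Proof. by rewrite card_imset //; exact: addIr. Qed.

Lemma maxclique_card (T : {set V}) : maxset (clique qok) T -> 0 \in T ->
  (#|T| <= #|V0| * #|proj1 T :&: rad|)%N.
Proof.
move=> mT T0; have [Tz q0] := maxclique_closed mT T0.
by rewrite -card_perp ?isotropic_card //; exact: proj1_zmod_closed.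
Qed.

(** Being a clique is invariant under translation, so T may be moved to contain 0 and then enlarged
    to a maximal clique, which is an isotropic subgroup. *)
Lemma qclique_le (T : {set V}) : clique qok T -> (#|T| <= clique_bound)%N.
Proof.
move=> cl; have [->|[t tT]] := set_0Vmem T; first by rewrite cards0.
have [U mU sTU] := maxset_exists (clique_shift t cl).
rewrite -(card_shift T t) (leq_trans (subset_leq_card sTU)) //.
have U0 : 0 \in U by apply: (fintype.subsetP sTU); apply/imsetP; exists t; rewrite /trans ?subrr.
apply: leq_trans (maxclique_card mU U0) _.
by rewrite leq_mul2l subset_leq_card ?orbT // subsetIr.
Qed.

(** This expresses surjectivity of S -> G: on vectors of coordinate sum 0 a labelling takes its
    values exactly in the subgroup generated by differences of labels. It depends only on the set of
    labels, as the clique estimate requires. *)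
Definition generating (T : {set V}) : bool :=
  `[< forall A : {set G}, zmod_closed A ->
       {in T &, forall t t', pr t.1 - pr t'.1 \in A} -> A = [set: G] >].

(** * Classification and count of the cliques of maximal size *)

Definition qtop := top_cliques qok generating clique_bound.
(** The matrices s for which the graph of x |-> x s is isotropic for Q. *)
Definition qsol : {set 'M['Z_N]_r} :=
  [set s | [forall x : V0, (x *m QQ *m x^T) 0 0 == (x *m s *m D *m x^T) 0 0]].
(** The graph of s thickened by the radical in the second coordinate, so that it reaches the maximal
    size. *)
Definition lagr (s : 'M['Z_N]_r) : {set V} := [set v | v.2 - v.1 *m s \in rad].

Lemma card_lagr s : #|lagr s| = clique_bound.
Proof.
have inj : injective (fun v : V => (v.1, v.2 - v.1 *m s)).
  by move=> [a b] [a' b'] /= [-> /addIr ->].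
rewrite -(card_imset _ inj) /clique_bound -[#|V0|]cardsT -cardsX; congr #|pred_of_set _|.
apply/setP => -[a b]; rewrite !inE /=; apply/imsetP/idP => [[v]|bR].
  by rewrite !inE => vs [_ ->].
by exists (a, b + a *m s); rewrite ?inE /= addrK.
Qed.

Lemma lagr0 s : 0 \in lagr s.
Proof. by rewrite inE /= mul0mx subr0; case: rad_zmod_closed. Qed.

Lemma lagr_top s : s \in qsol -> lagr s \in qtop.
Proof.
rewrite inE => /forallP solP; rewrite inE card_lagr eqxx /=; apply/andP; split.
  apply/cliqueP => u v; rewrite !inE => /eqP hu /eqP hv.
  pose w := u - v; rewrite /qok -/w.
  have : (w.2 - w.1 *m s) *m D = 0.
    have -> : w.2 - w.1 *m s = (u.2 - u.1 *m s) - (v.2 - v.1 *m s).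
      by rewrite /w /= mulmxBl !opprB [LHS]addrACA [RHS]addrACA [- v.2 + _]addrC.
    by rewrite mulmxBl hu hv subrr.
  rewrite mulmxBl => /eqP; rewrite subr_eq0 => /eqP hw.
  by rewrite /qform /bform /dpair hw (eqP (solP w.1)) subrr.
apply/asboolP => A Az hA; apply/setP => g; rewrite inE.
have [x <-] := pr_surj g; have := hA (x, x *m s) 0; rewrite lagr0 inE /= subrr.
by rewrite raddf0 subr0; apply=> //; case: rad_zmod_closed.
Qed.

Lemma scale_nat (a : 'Z_N) (m : nat) (A : 'M['Z_N]_(m, r)) : a *: A = A *+ a.
Proof. by rewrite -[a in LHS]natr_Zp scaler_nat. Qed.

Lemma zmod_closedD (A : zmodType) (S : {pred A}) : zmod_closed S ->
  {in S &, forall x y, x + y \in S}.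
Proof.
case=> S0 SB x y xS yS; rewrite -[y]opprK SB // -[- y]sub0r; exact: SB.
Qed.

Lemma zmod_closedMn (A : zmodType) (S : {pred A}) x n : zmod_closed S ->
  x \in S -> x *+ n \in S.
Proof.
move=> Sz xS; elim: n => [|n IHn]; first by case: Sz.
by rewrite mulrS; exact: zmod_closedD.
Qed.

(** Equality in the size bound puts the radical inside the projection X of T, and the generating
    condition makes X map onto G; together they give X = V0. The fibre over 0 is then exactly the
    radical, and T is the graph of a linear map up to the radical. *)
Lemma top_lagr (T : {set V}) : T \in qtop -> 0 \in T ->
  exists2 s, s \in qsol & T = lagr s.
Proof.
rewrite inE => /and3P[clT /eqP cT /asboolP gT] T0.
have mT : maxset (clique qok) T.
  apply/maxsetP; split=> // U clU sTU; apply/esym/eqP.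
  by rewrite eqEcard sTU cT qclique_le.
have [Tz q0] := maxclique_closed mT T0; have [_ TB] := Tz.
pose X := proj1 T; have Xz : zmod_closed X := proj1_zmod_closed Tz.
have radX : rad \subset X.
  have := maxclique_card mT T0; rewrite cT /clique_bound leq_pmul2l; last first.
    by apply/card_gt0P; exists 0.
  move=> le; apply/setIidPr/eqP; by rewrite eqEcard subsetIr.
have XT x : x \in X.
  have prX : [set pr x | x in X] = setT.
    apply: gT => [|u v uT vT]; last first.
      by rewrite -raddfB; apply/imsetP; exists (u.1 - v.1) => //; apply: (Xz.2); exact: imset_f.
    split=> [|_ _ /imsetP[u uX ->] /imsetP[v vX ->]]; last first.
      by apply/imsetP; exists (u - v); [apply: Xz.2|rewrite raddfB].
    by apply/imsetP; exists 0; [case: Xz|rewrite raddf0].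
  have : pr x \in [set pr x | x in X] by rewrite prX inE.
  case/imsetP => y yX prE; rewrite -[x](subrK y); apply: (zmod_closedD Xz) => //.
  by apply: (fintype.subsetP radX); rewrite inE -pr_ker raddfB /= prE subrr.
(* Isotropy against a full projection forces c into the radical; conversely (0, c) with c in the
   radical is compatible with every element of T, and maximality puts it in T. *)
have T0c c : ((0, c) \in T) = (c \in rad).
  apply/idP/idP => [cT'|cR].
    apply/radP => x; have /imsetP[v vT ->] := XT x.
    have := qformB (0, c) v; rewrite !q0 ?TB // qpolar0 opprK !add0r.
    by move=> <-.
  apply: (maxset_clique_subP qok_sym qok_refl mT) => t tT.
  by rewrite /qok qformB qform0c (q0 t) // qpolar0 dpair_rad // oppr0 !addr0 subrr.
have ex k : exists c, (delta_mx 0 k, c) \in T.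
  by have /imsetP[[a b] vT /= aE] := XT (delta_mx 0 k); exists b; rewrite aE.
(* Lifts of the basis vectors are chosen freely; T being a subgroup, the whole graph of s then lies
   in T. *)
pose s : 'M['Z_N]_r := \matrix_k xchoose (ex k).
have sT x : (x, x *m s) \in T.
  have -> : (x, x *m s) = \sum_k (delta_mx 0 k, row k s) *+ x 0 k :> V.
    have E (F : 'I_r -> V) : \sum_k F k = (\sum_k (F k).1, \sum_k (F k).2).
      by elim/big_rec3: _ => [//|k x1 x2 x3 _ ->].
    rewrite E; congr (_, _).
      rewrite [LHS]row_sum_delta; apply: eq_bigr => k _.
      rewrite scale_nat; by elim: (nat_of_ord _) => [//|m IHm]; rewrite !mulrS IHm.
    rewrite mulmx_sum_row; apply: eq_bigr => k _.
    rewrite scale_nat; by elim: (nat_of_ord _) => [//|m IHm]; rewrite !mulrS IHm.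
  elim/big_rec: _ => // k v _ vT; apply: (zmod_closedD Tz) => //.
  apply: zmod_closedMn => //; rewrite rowK; exact: (xchooseP (ex k)).
have TE : T = lagr s.
  apply/setP => -[x c]; rewrite inE /= -T0c.
  have E : (0, c - x *m s) = (x, c) - (x, x *m s) :> V by congr (_, _); rewrite /= subrr.
  rewrite E; apply/idP/idP => [|h]; first by move/TB; exact.
  by rewrite -[(x, c)](subrK (x, x *m s)); exact: zmod_closedD.
exists s => //; rewrite inE; apply/forallP => x.
by have := q0 _ (sT x); rewrite /qform /bform /dpair /= => /eqP; rewrite subr_eq0.
Qed.

Definition radM : {set 'M['Z_N]_r} := [set s | s *m D == 0].

(** Every s in [qsol] gives a top clique through 0, every such clique arises, and two matrices give
    the same one exactly when they differ by a matrix with rows in the radical. *)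
Lemma card_qsol : #|qsol| = (#|[set T in qtop | (0%R : V) \in T]| * #|radM|)%N.
Proof.
rewrite -sum1_card (partition_big lagr (mem [set T in qtop | (0%R : V) \in T])) /=; last first.
  by move=> s sS; rewrite inE lagr_top // lagr0.
rewrite -sum_nat_const; apply: eq_bigr => T; rewrite inE => /andP[Ttop T0].
have [s0 s0S ->] := top_lagr Ttop T0.
have lagrE s : lagr s = lagr s0 <-> s - s0 \in radM.
  rewrite inE; split=> [/setP h|/eqP h].
    apply/eqP/row_matrixP => k; rewrite row_mul row0.
    have := h (delta_mx 0 k, row k s); rewrite !inE /= -!rowE subrr mul0mx eqxx.
    by move/esym/eqP; rewrite -raddfB.
  have E : s *m D = s0 *m D by apply/eqP; rewrite -subr_eq0 -mulmxBl h.
  by apply/setP => v; rewrite !inE !mulmxBl -!mulmxA E.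
rewrite sum1_card -(card_imset (mem radM) (@addIr _ s0)); apply: eq_card => s.
rewrite unfold_in /=; apply/andP/imsetP => [[_ /eqP/lagrE h]|[t tR ->]].
  by exists (s - s0); rewrite ?subrK.
have hE : lagr (t + s0) = lagr s0 by apply/lagrE; rewrite addrK.
rewrite hE eqxx; split=> //; rewrite inE; apply/forallP => x.
have tD : t *m D = 0 by apply/eqP; rewrite inE in tR.
rewrite inE in s0S; rewrite (eqP (forallP s0S x)).
by rewrite -(mulmxA x s0) -(mulmxA x (t + s0)) mulmxDl tD add0r.
Qed.

Lemma generating_shift (T : {set V}) w :
  generating (trans w @: T) = generating T.
Proof.
have E (u v : V) : pr (trans w u).1 - pr (trans w v).1 = pr u.1 - pr v.1.
  by rewrite -raddfB -[RHS]raddfB; congr (pr _); rewrite /= opprB addrA subrK.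
apply: asbool_equiv_eq; split=> h A Az hA; apply: h => // t t'.
  by move=> /imsetP[u uT ->] /imsetP[u' u'T ->]; rewrite E; exact: hA.
by move=> tT t'T; rewrite -E; apply: hA; exact: imset_f.
Qed.

(** Double count of the pairs (T, v) with v in T: each T has M elements, and translation by v
    identifies the top cliques through v with those through 0. *)
Lemma card_qtop :
  (#|qtop| * clique_bound = #|{: V}| * #|[set T in qtop | (0%R : V) \in T]|)%N.
Proof.
have top_shift T w : T \in qtop -> (trans w @: T) \in qtop.
  rewrite !inE => /and3P[cl c g]; by rewrite clique_shift // card_shift c generating_shift g.
transitivity (\sum_(T in qtop) \sum_(v : V) (v \in T))%N.
  rewrite -sum_nat_const; apply: eq_bigr => T; rewrite inE => /and3P[_ /eqP <- _].
  by rewrite -sum1_card big_mkcond.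
rewrite exchange_big /= -sum_nat_const; apply: eq_bigr => v _.
rewrite -big_mkcondr /= sum1_card.
rewrite -(card_imset (mem [set T in qtop | (0%R : V) \in T])
  (f := fun T : {set V} => trans (- v) @: T)).
  apply: eq_card => T; rewrite unfold_in; apply/andP/imsetP => [[Ttop vT]|[U]].
    exists (trans v @: T).
      by rewrite inE top_shift //=; apply/imsetP; exists v; rewrite /trans ?subrr.
    rewrite -imset_comp -[LHS]imset_id; apply: eq_imset => t /=.
    by rewrite /trans opprK subrK.
  rewrite inE => /andP[Utop U0] ->; split; first exact: top_shift.
  by apply/imsetP; exists 0; rewrite /trans ?sub0r ?opprK.
by apply: imset_inj; exact: addIr.
Qed.

Lemma qtop_qsol : (#|qtop| * #|rad| * #|radM| = #|V0| * #|qsol|)%N.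
Proof.
have V0pos : (0 < #|V0|)%N by apply/card_gt0P; exists 0.
apply/eqP; rewrite -(eqn_pmul2l V0pos) card_qsol; apply/eqP.
have := card_qtop; rewrite /clique_bound card_prod.
move: #|qtop| #|V0| #|rad| #|radM| #|[set T in qtop | _]| => a b c e f h.
have : (a * (b * c) * e = b * b * f * e)%N by rewrite h.
lia.
Qed.

End MetricModule.

(** * Coordinates on a finite abelian group *)

Lemma finZmod_structure (G : finZmodType) : exists (r : nat) (g : 'I_r -> G) (a : 'I_r -> nat),
  [/\ forall k, (0 < a k)%N, forall k, (a k %| #|G|)%N,
      forall x, exists m : 'I_r -> nat, x = \sum_k g k *+ m k,
      forall m : 'I_r -> nat, (\sum_k g k *+ m k == 0) = [forall k, (a k %| m k)%N] &
      (\prod_k a k = #|G|)%N].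
Proof.
have abG : abelian [set: G] by exact: FinRing.zmod_abelian.
have [b bE _] := abelian_structure abG.
pose r := size b; pose g (k : 'I_r) : G := nth 0 b k.
have gE : \big[dprod/1%g]_(k < r) <[g k]>%g = [set: G]%G.
  by rewrite -[RHS]bE (big_nth 0) big_mkord.
exists r, g, (fun k => #[g k]%g); split.
- by move=> k; rewrite order_gt0.
- by move=> k; rewrite -cardsT; apply: order_dvdG; rewrite inE.
- move=> x; have [c [cP xE _]] := mem_bigdprod gE (in_setT x).
  have ex k : exists m, c k == (g k ^+ m)%g by have /cycleP[m ->] := cP k isT; exists m.
  exists (fun k => xchoose (ex k)); rewrite xE.
  elim/big_rec2: _ => [//|k y z _ ->]; rewrite FinRing.zmodMgE; congr (_ + _).
  by rewrite -FinRing.zmodXgE; apply/eqP; exact: (xchooseP (ex k)).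
- move=> m; have [c [_ _ cU]] := mem_bigdprod gE (in_setT 1%g).
  have sumE : \sum_k g k *+ m k = (\prod_k (g k ^+ m k))%g.
    apply: (big_rec2 (fun x y : G => x = y)) => [//|k y z _ ->].
    by rewrite FinRing.zmodMgE FinRing.zmodXgE.
  rewrite sumE; apply/eqP/forallP => [pE k|dv]; last first.
    by apply: big1 => k _; apply/eqP; rewrite -order_dvdn.
  rewrite order_dvdn; apply/eqP.
  rewrite (cU (fun k => g k ^+ m k)%g) ?pE // => [|j _]; last exact: mem_cycle.
  by apply/esym/(cU (fun=> 1%g)) => //; rewrite ?big1 // => j _; exact: group1.
- by rewrite (bigdprod_card gE) cardsT.
Qed.

Lemma card_fiber (A : finZmodType) (G : finZmodType) (pr : {additive A -> G}) g :
  (exists x, pr x = g) -> #|[set x | pr x == g]| = #|[set x | pr x == 0]|.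
Proof.
case=> x0 <-; rewrite -(card_imset (mem [set x | pr x == 0]) (@addrI _ x0)).
apply: eq_card => x; rewrite inE; apply/eqP/imsetP => [prE|[y]].
  by exists (x - x0); rewrite ?inE ?raddfB /= ?prE ?subrr // addrC subrK.
by rewrite inE => /eqP y0 ->; rewrite raddfD /= y0 addr0.
Qed.

(** Basis vectors give the diagonal entries and sums of two of them give the others, with no
    division by 2. A quadratic form thus has only one upper triangular matrix. *)
Lemma upper_tri_quad (R : nzRingType) r (A : 'M[R]_r) :
  (forall k l : 'I_r, (l < k)%N -> A k l = 0) ->
  (forall x : 'rV_r, (x *m A *m x^T) 0 0 = 0) -> A = 0.
Proof.
move=> tri quad.
have dE (k l : 'I_r) : ((delta_mx 0 k : 'rV_r) *m A *m (delta_mx 0 l : 'rV_r)^T) 0 0 = A k l.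
  by rewrite -rowE trmx_delta -colE !mxE.
have diag k : A k k = 0 by rewrite -dE quad.
have lt0 (k l : 'I_r) : (k < l)%N -> A k l = 0.
  move=> kl; have := quad (delta_mx 0 k + delta_mx 0 l).
  have addE (X Y : 'M[R]_1) : (X + Y) 0 0 = X 0 0 + Y 0 0 by rewrite mxE.
  rewrite raddfD /= mulmxDr !mulmxDl !addE !dE !diag.
  by rewrite (tri l k) // addr0 add0r addr0.
apply/matrixP => k l; rewrite mxE; case: (ltngtP k l) => [/lt0|/tri|/val_inj ->] //.
Qed.

Lemma quad_fold (R : comNzRingType) r (B : 'M[R]_r) (x : 'rV_r) :
  let U : 'M[R]_r := \matrix_(k, l)
    (if (k < l)%N then B k l + B l k else if k == l then B k k else 0) in
  (x *m U *m x^T) 0 0 = (x *m B *m x^T) 0 0.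
Proof.
move=> U; pose T : 'M[R]_r := \matrix_(k, l) (if (k <= l)%N then B k l else 0).
pose T' : 'M[R]_r := \matrix_(k, l) (if (l < k)%N then B k l else 0).
have -> : B = T + T'.
  by apply/matrixP => k l; rewrite !mxE; case: ltnP; rewrite ?addr0 ?add0r.
have -> : U = T + T'^T.
  apply/matrixP => k l; rewrite !mxE -val_eqE /=.
  by case: ltngtP => [||/val_inj ->]; rewrite ?addr0 ?add0r.
rewrite !mulmxDr !mulmxDl ![(_ + _ : 'M_1) 0 0]mxE; congr (_ + _).
by rewrite trmx11 !trmx_mul !trmxK mulmxA.
Qed.

Section Coordinates.
Variables (N r : nat) (a : 'I_r -> nat) (G : finZmodType) (g : 'I_r -> G).
Hypothesis N1 : (1 < N)%N.
Hypothesis a_gt0 : forall k, (0 < a k)%N.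
Hypothesis aaN : forall k l, (a k * a l %| N)%N.
Hypothesis gens : forall x, exists m : 'I_r -> nat, x = \sum_k g k *+ m k.
Hypothesis rels : forall m : 'I_r -> nat,
  (\sum_k g k *+ m k == 0) = [forall k, (a k %| m k)%N].

Local Notation V0 := 'rV['Z_N]_r.

Lemma aN k : (a k %| N)%N.
Proof. by apply: dvdn_trans (aaN k k); rewrite dvdn_mulr. Qed.

Lemma Zp_nat_eq0 (m : nat) : ((m%:R : 'Z_N) == 0) = (N %| m)%N.
Proof. by rewrite Zp_nat -val_eqE /= /dvdn Zp_cast. Qed.

Lemma Zp_divn_eq0 (m b : nat) : (b %| N)%N ->
  ((m%:R * (N %/ b)%:R : 'Z_N) == 0) = (b %| m)%N.
Proof.
move=> bN; have N0 := ltnW N1; have b0 := dvdn_gt0 N0 bN.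
rewrite -natrM Zp_nat_eq0 -[in X in (X %| _)%N](divnK bN) mulnC dvdn_pmul2r //.
by rewrite divn_gt0 // dvdn_leq.
Qed.

Lemma Zp_val_eq0 (t : 'Z_N) (b : nat) : (b %| N)%N ->
  ((t * (N %/ b)%:R) == 0) = (b %| t)%N.
Proof. by move=> bN; rewrite -[t in LHS]natr_Zp Zp_divn_eq0. Qed.

(** Multiplication by N / a_k embeds Z/a_k in Z/N, so divisibility of x_k by a_k becomes an equation
    in Z/N. *)
Definition mults : V0 := \row_k (N %/ a k)%:R.

Definition to_group (x : V0) : G := \sum_k g k *+ x 0 k.

Lemma g_order k : g k *+ a k = 0.
Proof.
have := rels (fun l => if l == k then a k else 0%N).
rewrite (bigD1 k) //= eqxx big1 ?addr0 => [|l /negPf -> //] h.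
by apply/eqP; rewrite h; apply/forallP => l; case: eqP => [->|_] //; rewrite dvdn0.
Qed.

Lemma g_mod k m : g k *+ (m %% N) = g k *+ m.
Proof.
have gN : g k *+ N = 0 by rewrite -(divnK (aN k)) mulnC mulrnA g_order mul0rn.
by rewrite [in RHS](divn_eq m N) mulrnDr mulnC mulrnA gN mul0rn add0r.
Qed.

Lemma g_addZp k (u v : 'Z_N) : g k *+ (u + v)%R = g k *+ u + g k *+ v.
Proof.
have -> : (u + v)%R = ((u + v) %% N)%N :> nat by exact: (congr1 (modn _) (Zp_cast N1)).
by rewrite g_mod mulrnDr.
Qed.

Lemma to_group_is_additive : zmod_morphism to_group.
Proof.
move=> x y; rewrite /to_group -sumrB; apply: eq_bigr => k _.
by rewrite !mxE; apply/eqP; rewrite eq_sym subr_eq -g_addZp subrK.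
Qed.

HB.instance Definition _ := GRing.isZmodMorphism.Build _ _ to_group to_group_is_additive.

Definition to_groupA : {additive V0 -> G} := to_group.

Lemma to_group_ker x : (to_group x == 0) = (x *m diag_mx mults == 0).
Proof.
rewrite /to_group rels; apply/forallP/eqP => [h|/rowP h k].
  by apply/rowP => k; rewrite mul_mx_diag !mxE; apply/eqP; rewrite Zp_val_eq0 ?aN.
by have := h k; rewrite mul_mx_diag !mxE => /eqP; rewrite Zp_val_eq0 ?aN.
Qed.

Lemma to_group_surj y : exists x, to_group x = y.
Proof.
have [m ->] := gens y; exists (\row_k (m k)%:R); apply: eq_bigr => k _.
by rewrite mxE Zp_nat /= Zp_cast // g_mod.
Qed.

Lemma card_rad : (#|rad mults| * #|G| = N ^ r)%N.
Proof.
have <- : #|V0| = (N ^ r)%N by rewrite card_mx card_ord mul1n Zp_cast.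
rewrite -[RHS]sum1_card (partition_big to_group predT) //= mulnC -sum_nat_const.
apply: eq_bigr => y _; rewrite sum1_card.
rewrite (@eq_card _ _ (mem [set x | to_group x == y])); last by move=> x; rewrite inE.
rewrite (card_fiber (to_group_surj y)); apply: eq_card => x.
by rewrite !inE to_group_ker.
Qed.

Lemma card_radM : #|radM mults| = (#|rad mults| ^ r)%N.
Proof.
transitivity #|(ffun_on (mem (rad mults)) : {pred {ffun 'I_r -> V0}})|; last first.
  by rewrite card_ffun_on card_ord.
have inj : injective (fun s : 'M['Z_N]_r => [ffun k => row k s]).
  by move=> s t /ffunP h; apply/row_matrixP => k; have := h k; rewrite !ffunE.
rewrite -(card_imset _ inj); apply: eq_card => f; apply/imsetP/ffun_onP => [[s sR ->] k|h].
  rewrite ffunE inE -row_mul; rewrite inE in sR; rewrite (eqP sR) row0 //.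
exists (\matrix_k f k); last by apply/ffunP => k; rewrite ffunE rowK.
rewrite inE; apply/eqP/row_matrixP => k; rewrite row_mul rowK row0.
by have := h k; rewrite inE => /eqP.
Qed.

(* A quadratic form has a unique upper triangular matrix, whence the junk value 0
   below the diagonal. *)
Definition qcoef (p : 'I_r * 'I_r) : 'Z_N :=
  if (p.1 <= p.2)%N then (N %/ (a p.1 * a p.2))%:R else 0.

(** The coefficients run over the whole of Z/N although only part of each matters. Every form is
    then hit #|qker| times, and testing a congruence modulo a_k a_l is a full character sum over
    Z/N. *)
Definition qmat (Q : {ffun 'I_r * 'I_r -> 'Z_N}) : 'M['Z_N]_r :=
  \matrix_(k, l) (Q (k, l) * qcoef (k, l)).

Definition qker : {set {ffun 'I_r * 'I_r -> 'Z_N}} :=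
  [set Q : {ffun 'I_r * 'I_r -> 'Z_N} | [forall p, Q p * qcoef p == 0]].

Lemma card_Zp_ann (b : nat) : (b %| N)%N ->
  (#|[set t : 'Z_N | (t * (N %/ b)%:R == 0)%R]| * b = N)%N.
Proof.
move=> bN; have N0 := ltnW N1; have b0 := dvdn_gt0 N0 bN.
have ltN (i : 'I_(N %/ b)) : (i * b < (Zp_trunc N).+2)%N.
  by rewrite Zp_cast // -[X in (_ < X)%N](divnK bN) ltn_pmul2r.
pose h (i : 'I_(N %/ b)) : 'Z_N := Ordinal (ltN i).
have inj : injective h.
  by move=> i j /(congr1 val) /= /eqP; rewrite eqn_pmul2r // => /eqP/val_inj.
rewrite -[RHS](divnK bN); congr (_ * _)%N; rewrite -[RHS]card_ord -[RHS](card_imset _ inj).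
apply: eq_card => t; rewrite inE Zp_val_eq0 //; apply/idP/imsetP => [bt|[k _ ->]]; last first.
  by rewrite /= dvdn_mull.
have lt : (t %/ b < N %/ b)%N by rewrite ltn_divRL // divnK // -[X in (_ < X)%N](Zp_cast N1).
by exists (Ordinal lt) => //; apply/val_inj; rewrite /= divnK.
Qed.

(** The exponent r + 1 counts the occurrences of a_k in the products a_k a_l over pairs k <= l: two
    on the diagonal and one for each of the r - 1 other indices. *)
Lemma card_qker : (#|qker| * (\prod_k a k) ^ r.+1 = N ^ (r * r))%N.
Proof.
have -> : (N ^ (r * r) = \prod_(p : 'I_r * 'I_r) N)%N.
  by rewrite prod_nat_const card_prod card_ord.
have -> : ((\prod_k a k) ^ r.+1 =
   \prod_(p : 'I_r * 'I_r) (if (p.1 <= p.2)%N then a p.1 * a p.2 else 1))%N.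
  rewrite -(pair_bigA _ (fun k l : 'I_r => if (k <= l)%N then a k * a l else 1)%N) /=.
  have -> : (\prod_(k < r) \prod_(l < r) (if (k <= l)%N then a k * a l else 1) =
     \prod_(k < r) \prod_(l < r) (if (k <= l)%N then a k else 1) *
     \prod_(k < r) \prod_(l < r) (if (l <= k)%N then a k else 1))%N.
    rewrite [X in (_ * X)%N]exchange_big /= -big_split /=; apply: eq_bigr => k _.
    by rewrite -big_split /=; apply: eq_bigr => l _; case: ifP.
  rewrite -big_split (big_morph (fun x => x ^ r.+1)%N (fun x y => expnMn x y _) (exp1n _)) /=.
  apply: eq_bigr => k _; rewrite -big_split /= (bigD1 k) //= leqnn.
  rewrite (eq_bigr (fun=> a k)) => [|l /negPf lk]; last first.
    by move: lk; rewrite -val_eqE /=; case: ltngtP => // _ _; rewrite ?mul1n ?muln1.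
  rewrite prod_nat_const -mulnA -!expnS; congr (_ ^ _.+1)%N.
  by rewrite cardC1 card_ord prednK // (leq_ltn_trans (leq0n k)).
have -> : #|qker| = (\prod_p #|[set t : 'Z_N | (t * qcoef p == 0)%R]|)%N.
  rewrite (@eq_card _ _ (mem (family (fun p => mem [set t : 'Z_N | (t * qcoef p == 0)%R])))).
    by rewrite card_family foldrE big_image.
  by move=> Q; rewrite inE; apply: eq_forallb => p; rewrite !inE.
rewrite -big_split; apply: eq_bigr => p _ /=; rewrite /qcoef; case: ifP => _.
  exact: card_Zp_ann.
rewrite muln1 -[RHS](Zp_cast N1) -[RHS]card_ord -cardsT; apply: eq_card => t.
by rewrite !inE mulr0 eqxx.
Qed.

Lemma mults_coef k l : (a k)%:R * (N %/ (a k * a l))%:R = mults 0 l :> 'Z_N.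
Proof.
rewrite mxE -natrM; congr (_%:R); rewrite muln_divA ?aaN // mulnC divnMA.
by rewrite mulnK.
Qed.


(* The upper triangular form equal to x |-> x s D x^T, divided by [qcoef]. *)
Definition qfold (s : 'M['Z_N]_r) : {ffun 'I_r * 'I_r -> 'Z_N} :=
  [ffun p => if p.1 == p.2 then s p.1 p.2 * (a p.1)%:R
             else s p.1 p.2 * (a p.1)%:R + s p.2 p.1 * (a p.2)%:R].

Lemma qmat_qfold s : qmat (qfold s) = \matrix_(k, l)
  (if (k < l)%N then s k l * mults 0 l + s l k * mults 0 k
   else if k == l then s k k * mults 0 k else 0).
Proof.
apply/matrixP => k l; rewrite [LHS]mxE [RHS]mxE ffunE /qcoef /=.
have [kl|lk|/val_inj ->] := ltngtP k l.
- have /negPf -> : k != l by apply: contraTneq kl => ->; rewrite ltnn.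
  by rewrite mulrDl -!mulrA mults_coef [in X in _ + X]mulnC mults_coef.
- by rewrite mulr0; case: eqP => // kl; rewrite kl ltnn in lk.
- by rewrite eqxx -mulrA mults_coef.
Qed.

Lemma quad_qfold s (x : V0) :
  (x *m qmat (qfold s) *m x^T) 0 0 = (x *m s *m diag_mx mults *m x^T) 0 0.
Proof.
rewrite -(mulmxA x s) -[RHS]quad_fold qmat_qfold; congr ((_ *m _ *m _) 0 0).
by apply/matrixP => k l; rewrite mul_mx_diag !mxE.
Qed.

Lemma qsol_qmat Q s : (s \in qsol mults (qmat Q)) = (qmat Q == qmat (qfold s)).
Proof.
rewrite inE; apply/forallP/eqP => [h|-> x]; last by rewrite quad_qfold.
apply/eqP; rewrite -subr_eq0; apply/eqP/upper_tri_quad => [k l lk|x].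
  by rewrite !mxE /qcoef /= leqNgt lk !mulr0 subrr.
by rewrite mulmxBr mulmxBl sub_mxE quad_qfold (eqP (h x)) subrr.
Qed.

Lemma card_qmat_fiber Q1 : #|[set Q | qmat Q == qmat Q1]| = #|qker|.
Proof.
pose h Q : {ffun 'I_r * 'I_r -> 'Z_N} := [ffun p => Q p + Q1 p].
have inj : injective (fun Q : {ffun 'I_r * 'I_r -> 'Z_N} => h Q).
  by move=> Q Q' /ffunP hE; apply/ffunP => p; have := hE p; rewrite !ffunE => /addIr.
rewrite -(card_imset (mem qker) inj); apply: eq_card => Q; rewrite inE.
apply/eqP/imsetP => [/matrixP qE|[Q' Q'K ->]].
  exists [ffun p => Q p - Q1 p]; last by apply/ffunP => p; rewrite !ffunE subrK.
  rewrite inE; apply/forallP => -[k l]; rewrite ffunE mulrBl subr_eq0.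
  by have := qE k l; rewrite !mxE => ->.
rewrite inE in Q'K; apply/matrixP => k l; rewrite !mxE ffunE mulrDl.
by rewrite (eqP (forallP Q'K (k, l))) add0r.
Qed.

Variables (C : numFieldType) (psi : 'Z_N -> C) (B : 'I_r * 'I_r -> 'Z_N).
Hypothesis psi0 : psi 0 = 1.
Hypothesis B1 : forall p, mults 0 p.1 * B p = 0.
Hypothesis B2 : forall p, mults 0 p.2 * B p = 0.

(** If the form of Q comes from some s, its coefficients are combinations of d_k and d_l, which
    annihilate B; the character is therefore 1 on every Q that counts. Exchanging the sums, each of
    the N ^ (r * r) matrices s receives one coset of [qker]. *)
Lemma sum_psi_qsol :
  \sum_(Q : {ffun 'I_r * 'I_r -> 'Z_N})
     psi (- \sum_p qmat Q p.1 p.2 * B p) * #|qsol mults (qmat Q)|%:R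
  = (N ^ (r * r) * #|qker|)%:R.
Proof.
have -> : (N ^ (r * r) * #|qker|)%:R = \sum_(s : 'M['Z_N]_r) #|qker|%:R :> C.
  have cM : #|{: 'M['Z_N]_r}| = (N ^ (r * r))%N by rewrite card_mx card_ord Zp_cast.
  by rewrite sumr_const cM natrM mulr_natl.
have E (Q : {ffun 'I_r * 'I_r -> 'Z_N}) :
    psi (- \sum_p qmat Q p.1 p.2 * B p) * #|qsol mults (qmat Q)|%:R
    = \sum_(s : 'M['Z_N]_r) (qmat Q == qmat (qfold s))%:R :> C.
  rewrite -sum1_card natr_sum mulr_sumr big_mkcond /=; apply: eq_bigr => s _.
  rewrite qsol_qmat; case: eqP => // ->; rewrite big1 ?oppr0 ?psi0 ?mulr1 // => -[k l] _ /=.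
  rewrite qmat_qfold mxE; case: ifP => _.
    by rewrite mulrDl -!mulrA (B1 (k, l)) (B2 (k, l)) !mulr0 addr0.
  by case: eqP => [->|_]; rewrite ?mul0r // -mulrA (B1 (l, l)) mulr0.
under eq_bigr => Q _ do rewrite E.
rewrite exchange_big /=; apply: eq_bigr => s _.
rewrite -(card_qmat_fiber (qfold s)) -sum1_card natr_sum [RHS]big_mkcond /=.
by apply: eq_bigr => Q _; rewrite inE; case: eqP.
Qed.

End Coordinates.

Local Open Scope quotient_scope.

(** * From surjections to vertex labels *)

Section HomOfLabels.
Variables (G : finZmodType) (b : pdual G -> pdual G -> QZ).

Definition label_hom n (f : {ffun 'I_n -> G}) (v : 'cV[int]_n) : G := \sum_i f i *~ v i 0.

Lemma label_hom_is_additive n f : zmod_morphism (@label_hom n f).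
Proof.
move=> u v; rewrite /label_hom -sumrB; apply: eq_bigr => i _.
by rewrite sub_mxE mulrzBr.
Qed.

HB.instance Definition _ n f :=
  GRing.isZmodMorphism.Build _ _ (@label_hom n f) (label_hom_is_additive f).

Lemma label_hom_delta n (f : {ffun 'I_n -> G}) i : label_hom f (delta_mx i 0) = f i.
Proof.
rewrite /label_hom (bigD1 i) //= mxE !eqxx big1 ?addr0 // => j /negPf ji.
by rewrite mxE ji.
Qed.

(** A labelling is a homomorphism from Z^n, which the second clause makes factor through cok L.
    Surjectivity is still asked on Z only, and the pairing is computed on cok L, where no extension
    has to be chosen. *)
Definition good_label n (gr : graph n) (f : {ffun 'I_n -> G}) : Prop :=
  [/\ forall y, exists z : Zsum0 n, label_hom f (val z) = y,
      forall v, label_hom f (laplacian gr *m v) = 0 &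
      forall u v : pdual G,
        cok_pairing (laplacian gr) (u \o label_hom f) (v \o label_hom f) = b u v].

Lemma additive_ext (A B : zmodType) (F F' : {additive A -> B}) : F =1 F' -> F = F'.
Proof.
case: F F' => [F [[F1]]] [F' [[F1']]] /= /funext FF'.
case: _ / FF' in F1' *.
by have -> : F1 = F1' by exact: Prop_irrelevance.
Qed.

Lemma sandpile_pi_im n (gr : graph n) (z : Zsum0 n) (v : 'cV[int]_n) :
  val z = laplacian gr *m v -> \pi_(sandpile gr) z = 0.
Proof.
move=> zE; apply/eqP; rewrite -(raddf0 \pi_(sandpile gr)) -Quotient.idealrBE subr0 unfold_in.
by apply/asboolP; exists v.
Qed.

Lemma Sur_star_label n (gr : graph n) (F : {additive sandpile gr -> G}) f :
  (forall z, F (\pi_(sandpile gr) z) = label_hom f (val z)) ->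
  Sur_star b gr F <-> good_label gr f.
Proof.
move=> Ff.
have fL v : label_hom f (laplacian gr *m v) = 0.
  rewrite -(Ff (MkZsum0 (laplacian_zero_sum gr v))) (@sandpile_pi_im _ _ _ v) //.
  by rewrite raddf0.
have pE (u v : pdual G) : sandpile_pairing (u \o F) (v \o F) =
    cok_pairing (laplacian gr) (u \o label_hom f) (v \o label_hom f).
  apply: sandpile_pairingE => [w|z|w|z] /=; rewrite ?fL ?raddf0 ?Ff //.
split=> [[sur pairing]|[sur _ pairing]].
  split=> // [y|u v]; last by rewrite -pE pairing.
  by have [s <-] := sur y; exists (generic_quotient.repr s); rewrite -Ff reprK.
split=> [y|u v]; last by rewrite pE pairing.
by have [z <-] := sur y; exists (\pi_(sandpile gr) z); rewrite Ff.
Qed.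

Lemma label_sandpile_hom n (gr : graph n) f :
  (forall v, label_hom f (laplacian gr *m v) = 0) ->
  exists F : {additive sandpile gr -> G},
    forall z, F (\pi_(sandpile gr) z) = label_hom f (val z).
Proof.
move=> fL; pose F (s : sandpile gr) : G := label_hom f (val (generic_quotient.repr s)).
have FE z : F (\pi_(sandpile gr) z) = label_hom f (val z).
  have : generic_quotient.repr (\pi_(sandpile gr) z) - z \in im_laplacian gr.
    by rewrite Quotient.idealrBE reprK.
  rewrite unfold_in => /asboolP[v vE]; apply/eqP; rewrite -subr_eq0.
  have -> : F (\pi_(sandpile gr) z) - label_hom f (val z)
      = label_hom f (val (generic_quotient.repr (\pi_(sandpile gr) z) - z)).
    by rewrite !raddfB.
  by rewrite vE fL.
have Fa : zmod_morphism F.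
  move=> s t; rewrite -[s]reprK -[t]reprK -raddfB !FE.
  by rewrite !raddfB.
pose F' : {additive sandpile gr -> G} :=
  HB.pack F (GRing.isZmodMorphism.Build _ _ F Fa).
by exists F'.
Qed.

Lemma card_Sur_star n (gr : graph n.+1) :
  (#|` fset_set (Sur_star b gr)| * #|G| = #|[set f | `[< good_label gr f >]]|)%N.
Proof.
pose S : seq {classic {additive sandpile gr -> G}} := enum_fset (fset_set (Sur_star b gr)).
pose e (i : 'I_n.+1) : sandpile gr := \pi_(sandpile gr) (MkZsum0 (Zsum0_gen i 0)).
(* Vertex 0 is the base point: y is its label, and F applied to e_i - e_0 gives the difference of
   the labels of i and 0. This is why a vertex is required. *)
pose h (F : {classic {additive sandpile gr -> G}}) (y : G) : {ffun 'I_n.+1 -> G} :=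
  [ffun i => (F : {additive sandpile gr -> G}) (e i) + y].
have hF (F : {additive sandpile gr -> G}) y z :
    F (\pi_(sandpile gr) z) = label_hom (h F y) (val z).
  have zE : z = \sum_i MkZsum0 (Zsum0_gen i 0) *~ val z i 0.
    apply: val_inj; rewrite raddf_sum.
    under eq_bigr do rewrite raddfMz /= mulrzBl.
    rewrite sumrB -mulrz_sumr; have /eqP -> := valP z.
    rewrite mulr0z subr0 [LHS]matrix_sum_delta; apply: eq_bigr => k _.
    by rewrite big_ord1 -scaler_int intz.
  rewrite {1}zE !raddf_sum /label_hom.
  under [RHS]eq_bigr => i _ do rewrite ffunE mulrzDl.
  rewrite big_split /= -mulrz_sumr; have /eqP -> := valP z; rewrite mulr0z addr0.
  by apply: eq_bigr => i _; rewrite !raddfMz.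
have memS (F : {classic {additive sandpile gr -> G}}) :
    (F \in S) = (F \in fset_set (Sur_star b gr)) by [].
have e0 : e 0 = 0.
  rewrite /e -[RHS](raddf0 \pi_(sandpile gr)); congr (\pi_(sandpile gr) _).
  by apply: val_inj; rewrite /= subrr.
have h_inj (F F' : {classic {additive sandpile gr -> G}}) y y' :
    h F y = h F' y' -> F = F' /\ y = y'.
  move=> hE; have yE : y = y'.
    by have /ffunP/(_ 0) := hE; rewrite !ffunE e0 !raddf0 !add0r.
  split=> //; apply: additive_ext => s.
  by rewrite -[s]reprK (hF F y) (hF F' y) hE yE.
have -> : (#|` fset_set (Sur_star b gr)| * #|G|)%N = size [seq h F y | F <- S, y <- enum G].
  by rewrite size_allpairs -cardE.
rewrite cardE; apply: perm_size; apply: uniq_perm; last 1 first.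
- move=> f; rewrite mem_enum inE; apply/allpairsP/asboolP => [[[F y] [/= FS _ ->]]|gf].
    apply/(Sur_star_label (hF F y)); move: FS.
    rewrite memS in_fset_set; last exact: Sur_star_finite.
    by move/set_mem.
  have [_ fL _] := gf; have [F Ff] := label_sandpile_hom fL.
  exists (F : {classic _}, f 0); split=> /=; rewrite ?mem_enum //.
    rewrite memS in_fset_set; last exact: Sur_star_finite.
    by apply/mem_set/(Sur_star_label Ff).
  apply/ffunP => i; rewrite ffunE Ff /= raddfB /= !label_hom_delta subrK //.
- apply: allpairs_uniq; rewrite ?enum_uniq //; first exact: fset_uniq.
  by move=> [F y] [F' y'] _ _ /= /h_inj[-> ->].
- exact: enum_uniq.
Qed.

End HomOfLabels.

(** * Characters of G and their pairings in coordinates *)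

Lemma rat_divn_int (z : int) (m : nat) : (0 < m)%N ->
  ((z%:~R / m%:R : rat) \is a Num.int) = (m%:Z %| z)%Z.
Proof.
move=> m0; have m0' : m%:R != 0 :> rat by rewrite pnatr_eq0 -lt0n.
apply/intrP/dvdzP => [[t tE]|[t ->]]; exists t; last by rewrite intrM -pmulrn mulfK.
apply/(@intr_inj rat); rewrite intrM -pmulrn -tE divfK //.
Qed.

Lemma QZ_divn_eq (z z' : int) (m : nat) : (0 < m)%N ->
  (\pi_QZ (z%:~R / m%:R) == \pi_QZ (z'%:~R / m%:R)) = (m%:Z %| z - z')%Z.
Proof.
move=> m0; rewrite -rat_divn_int // intrB mulrBl.
by apply/eqP/idP => [/QZ_eqP|/QZ_eqP].
Qed.

Lemma QZ_torsion (y : QZ) (m : nat) : (0 < m)%N -> y *+ m = 0 ->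
  exists t : nat, y = \pi_QZ (t%:R / m%:R).
Proof.
move=> m0; rewrite -[y]reprK; set x := generic_quotient.repr y.
have m0' : m%:R != 0 :> rat by rewrite pnatr_eq0 -lt0n.
rewrite -raddfMn -(raddf0 \pi_QZ) => /QZ_eqP; rewrite subr0 => /intrP[z zE].
have xE : x = z%:~R / m%:R by rewrite -zE -[x *+ m]mulr_natr mulfK.
exists `|(z %% m%:Z)%Z|%N; rewrite xE (pmulrn _ `|_|%N); apply/eqP; rewrite QZ_divn_eq //.
rewrite gez0_abs ?modz_ge0 ?pnatr_eq0 -?lt0n //.
by apply/dvdzP; exists (z %/ m%:Z)%Z; rewrite {1}(divz_eq z m%:Z) addrK.
Qed.

Section PairingCoordinates.
Variables (N r : nat) (a : 'I_r -> nat) (G : finZmodType) (g : 'I_r -> G).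
Hypothesis N1 : (1 < N)%N.
Hypothesis a_gt0 : forall k, (0 < a k)%N.
Hypothesis aaN : forall k l, (a k * a l %| N)%N.
Hypothesis gens : forall x, exists m : 'I_r -> nat, x = \sum_k g k *+ m k.
Hypothesis rels : forall m : 'I_r -> nat,
  (\sum_k g k *+ m k == 0) = [forall k, (a k %| m k)%N].

Local Notation V0 := 'rV['Z_N]_r.
Local Notation pr := (to_groupA N1 aaN rels).

Lemma Zp_int_eq0 (z : int) (m : nat) : (m %| N)%N ->
  ((z%:~R * (N %/ m)%:R : 'Z_N) == 0) = (m%:Z %| z)%Z.
Proof.
move=> mN; case: z => z; first by rewrite -pmulrn Zp_divn_eq0.
by rewrite NegzE rmorphN /= mulNr oppr_eq0 -pmulrn Zp_divn_eq0 // dvdzN.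
Qed.

(** These characters serve as the dual basis of [g]. *)
Lemma coord_char_exists k : exists e : pdual G,
  forall x, e (pr x) = \pi_QZ ((x 0 k)%:R / (a k)%:R).
Proof.
pose e0 (x : V0) : QZ := \pi_QZ ((x 0 k)%:R / (a k)%:R).
have e0P (x y : V0) : pr x = pr y -> e0 x = e0 y.
  move=> prE; have : pr (x - y) == 0 by rewrite raddfB /= prE subrr.
  rewrite (to_group_ker N1 aaN rels) => /eqP/rowP/(_ k).
  rewrite mul_mx_diag !mxE => /eqP.
  rewrite -[x 0 k]natr_Zp -[y 0 k]natr_Zp !pmulrn -intrB Zp_int_eq0 ?(aN aaN) //.
  by move=> dv; apply/eqP; rewrite /e0 !pmulrn QZ_divn_eq.
have ex y : exists x, pr x == y by have [x <-] := to_group_surj N1 aaN gens rels y; exists x.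
pose sec y := xchoose (ex y); have secK y : pr (sec y) = y by apply/eqP/(xchooseP (ex y)).
have e0B x y : e0 (x - y) = e0 x - e0 y.
  rewrite /e0 -raddfB -mulrBl /= !pmulrn -intrB; apply/eqP; rewrite QZ_divn_eq //.
  have kN := aN aaN k; rewrite -Zp_int_eq0 // !intrB -!pmulrn !natr_Zp !mxE subrr mul0r //.
pose e y : QZ := e0 (sec y).
have ea : zmod_morphism e.
  by move=> y y'; rewrite /e -e0B; apply: e0P; rewrite raddfB !secK.
pose E : pdual G := HB.pack e (GRing.isZmodMorphism.Build _ _ e ea).
by exists E => x; rewrite /= /e (e0P _ x).
Qed.

Variable eps : 'I_r -> pdual G.
Hypothesis epsE : forall k x, eps k (pr x) = \pi_QZ ((x 0 k)%:R / (a k)%:R).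

Lemma pdual_decomp (u : pdual G) : exists m : 'I_r -> nat,
  forall y, u y = \sum_k eps k y *+ m k.
Proof.
have ex k : exists t : nat, u (g k) = \pi_QZ (t%:R / (a k)%:R).
  by apply: QZ_torsion => //; rewrite -raddfMn /= (g_order rels) raddf0.
have [m mE] := choice ex; exists m => y.
have [x <-] := to_group_surj N1 aaN gens rels y.
rewrite raddf_sum; apply: eq_bigr => k _; rewrite raddfMn /= mE.
rewrite -[to_group g x]/(pr x) epsE -!raddfMn /=; congr (\pi_QZ _).
rewrite -[LHS]mulr_natr -[RHS]mulr_natr [LHS]mulrAC [RHS]mulrAC.
by rewrite [(m k)%:R * _]mulrC.
Qed.

(** Biadditivity of a pairing is stated with [\+] alone, so the dual group is exhausted by repeated
    addition of the [eps k]; nonnegative multiples suffice because each [eps k] has finite order. *)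
Lemma pdual_eps_ind (P : pdual G -> Prop) :
  P (\0 : pdual G) -> (forall k (u : pdual G), P u -> P (eps k \+ u)) -> forall u, P u.
Proof.
move=> P0 PD u; have [m mE] := pdual_decomp u.
have H (s : seq 'I_r) : exists2 w : pdual G, P w & forall y, w y = \sum_(k <- s) eps k y *+ m k.
  elim: s => [|k s [w Pw wE]]; first by exists (\0 : pdual G) => // y; rewrite big_nil.
  have [w' Pw' wE'] : exists2 w' : pdual G, P w' & forall y, w' y = eps k y *+ m k + w y.
    elim: (m k) => [|j [w' Pw' wE']]; first by exists w => // y; rewrite add0r.
    exists (eps k \+ w') => [|y /=]; first exact: PD.
    by rewrite wE' mulrS addrA.
  by exists w' => // y; rewrite big_cons wE' wE.
have [w Pw wE] := H (index_enum 'I_r).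
by have -> : u = w by apply: additive_ext => y; rewrite mE wE.
Qed.

Lemma biadditive_eq (b b' : pdual G -> pdual G -> QZ) :
  (forall u v w : pdual G, b (u \+ v) w = b u w + b v w) ->
  (forall u v w : pdual G, b u (v \+ w) = b u v + b u w) ->
  (forall u v w : pdual G, b' (u \+ v) w = b' u w + b' v w) ->
  (forall u v w : pdual G, b' u (v \+ w) = b' u v + b' u w) ->
  (forall k l, b (eps k) (eps l) = b' (eps k) (eps l)) -> forall u v, b u v = b' u v.
Proof.
move=> bDl bDr b'Dl b'Dr bE.
have z0 : (\0 : pdual G) = (\0 : pdual G) \+ (\0 : pdual G).
  by apply: additive_ext => y; rewrite /= addr0.
have idem (x : QZ) : x = x + x -> x = 0 by move/eqP; rewrite eq_sym -subr_eq0 addrK => /eqP.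
have c0 (c : pdual G -> QZ) : (forall v w : pdual G, c (v \+ w) = c v + c w) ->
    c (\0 : pdual G) = 0.
  by move=> cD; apply: idem; rewrite -cD -z0.
apply: pdual_eps_ind => [v|k u IHu v]; last first.
  rewrite bDl b'Dl IHu; congr (_ + _); move: v; apply: pdual_eps_ind => [|l v IHv].
    by rewrite (c0 (b (eps k))) // (c0 (b' (eps k))).
  by rewrite bDr b'Dr IHv bE.
by rewrite (c0 (b^~ v)) // (c0 (b'^~ v)).
Qed.

Variable b : pdual G -> pdual G -> QZ.
Hypothesis hb : symmetric_pairing b.

(** The value is killed by a_k and by a_l. Written over a_k a_l, the denominator in which X L Y^t
    appears, it has a numerator divisible by both; these divisibilities make the character in
    [sum_psi_qsol] trivial. *)
Lemma pairing_coords : exists B : 'I_r * 'I_r -> nat, forall p,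
  [/\ b (eps p.1) (eps p.2) = \pi_QZ ((B p)%:R / (a p.1 * a p.2)%:R),
      (a p.1 %| B p)%N & (a p.2 %| B p)%N].
Proof.
have [bC bDl _] := hb.
have z0 : (\0 : pdual G) = (\0 : pdual G) \+ (\0 : pdual G).
  by apply: additive_ext => y; rewrite /= addr0.
have b0 v : b (\0 : pdual G) v = 0.
  have : b (\0 : pdual G) v = b (\0 : pdual G) v + b (\0 : pdual G) v by rewrite -bDl -z0.
  by move/eqP; rewrite eq_sym -subr_eq0 addrK => /eqP.
have tors k v : b (eps k) v *+ a k = 0.
  have [w wE bw] : exists2 w : pdual G, (forall y, w y = eps k y *+ a k)
      & b w v = b (eps k) v *+ a k.
    elim: (a k) => [|j [w wE bw]]; first by exists (\0 : pdual G).
    by exists (eps k \+ w) => [y /=|]; rewrite ?bDl ?wE ?bw mulrS.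
  rewrite -bw (_ : w = \0 :> pdual G) //; apply: additive_ext => y; rewrite wE /=.
  have [x <-] := to_group_surj N1 aaN gens rels y.
  rewrite -[to_group g x]/(pr x) epsE -raddfMn -(raddf0 \pi_QZ); apply/QZ_eqP.
  by rewrite subr0 -[_ / _ *+ _]mulr_natr divfK ?pnatr_eq0 -?lt0n // natr_int.
suff ex p : exists t : nat, [/\ b (eps p.1) (eps p.2) = \pi_QZ (t%:R / (a p.1 * a p.2)%:R),
    (a p.1 %| t)%N & (a p.2 %| t)%N].
  by have [B BP] := choice ex; exists B.
case: p => k l /=.
have [t tE] := QZ_torsion (a_gt0 k) (tors k (eps l)).
exists (t * a l)%N; split.
- by rewrite tE; congr (\pi_QZ _); rewrite !natrM -mulf_div divff ?mulr1 // pnatr_eq0 -lt0n.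
- have := tors l (eps k); rewrite bC tE -raddfMn -(raddf0 \pi_QZ) => /QZ_eqP.
  rewrite subr0 -[_ / _ *+ _]mulr_natr mulrAC -natrM (pmulrn _ (t * a l)%N) rat_divn_int //.
- exact: dvdn_mull.
Qed.

Variable B : 'I_r * 'I_r -> nat.
Hypothesis BE : forall p,
  b (eps p.1) (eps p.2) = \pi_QZ ((B p)%:R / (a p.1 * a p.2)%:R).

Variables (n : nat) (gr : graph n) (X : {ffun 'I_n -> V0}).
Local Notation L := (laplacian gr).
Local Notation f := [ffun i => pr (X i)].

Lemma label_laplacian_coords :
  (forall v, label_hom f (L *m v) = 0) <->
  (forall j, (\sum_i X i *~ L i j) *m diag_mx (mults N a) = 0).
Proof.
have fE j : label_hom f (col j L) = pr (\sum_i X i *~ L i j).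
  by rewrite raddf_sum; apply: eq_bigr => i _; rewrite ffunE mxE raddfMz.
split=> [h j|h v].
  apply/eqP; rewrite -(to_group_ker N1 aaN rels) -[to_group g _]/(pr _) -fE.
  by rewrite colE h.
have h' j : label_hom f (col j L) = 0.
  by apply/eqP; rewrite fE -[pr _]/(to_group g _) (to_group_ker N1 aaN rels) h.
rewrite [v]matrix_sum_delta mulmx_sumr raddf_sum big1 // => j _.
by rewrite big_ord1 -scalemxAr -colE -[v j 0]intz scaler_int raddfMz /= h' mul0rz.
Qed.

Definition coord_sum (p : 'I_r * 'I_r) : int :=
  \sum_i \sum_j (X i 0 p.1)%:Z * L i j * (X j 0 p.2)%:Z.

Lemma cok_pairing_coords (u v : pdual G) (x y : 'rV[rat]_n) :
  (forall w, label_hom f (L *m w) = 0) ->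
  (forall i, u (pr (X i)) = \pi_QZ (x 0 i)) -> (forall i, v (pr (X i)) = \pi_QZ (y 0 i)) ->
  cok_pairing L (u \o label_hom f) (v \o label_hom f)
  = \pi_QZ ((x *m map_mx intr L *m y^T) 0 0).
Proof.
move=> fL hx hy; apply: cok_pairingE; first exact: laplacian_tr.
- by move=> w /=; rewrite fL raddf0.
- by move=> w /=; rewrite fL raddf0.
- by move=> i /=; rewrite label_hom_delta ffunE hx.
- by move=> i /=; rewrite label_hom_delta ffunE hy.
Qed.

Lemma cok_pairing_eps k l : (forall w, label_hom f (L *m w) = 0) ->
  cok_pairing L (eps k \o label_hom f) (eps l \o label_hom f)
  = \pi_QZ ((coord_sum (k, l))%:~R / (a k * a l)%:R).
Proof.
move=> fL; rewrite (@cok_pairing_coords _ _ (\row_i ((X i 0 k)%:R / (a k)%:R))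
  (\row_i ((X i 0 l)%:R / (a l)%:R))) //; last 2 first.
- by move=> i; rewrite epsE mxE.
- by move=> i; rewrite epsE mxE.
congr (\pi_QZ _); rewrite mxE /coord_sum exchange_big /= rmorph_sum mulr_suml.
apply: eq_bigr => j _; rewrite !mxE mulr_suml rmorph_sum mulr_suml /=.
apply: eq_bigr => i _; rewrite !mxE !rmorphM /= -!pmulrn ?natrM invfM.
set A := (a k)%:R^-1; set A' := (a l)%:R^-1; ring.
Qed.

Lemma cok_pairing_biadditive : (forall w, label_hom f (L *m w) = 0) ->
  let c (u v : pdual G) := cok_pairing L (u \o label_hom f) (v \o label_hom f) in
  [/\ forall u v, c u v = c v u,
      forall u v w : pdual G, c (u \+ v) w = c u w + c v w &
      forall u v w : pdual G, c u (v \+ w) = c u v + c u w].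
Proof.
move=> fL c; pose lift (u : pdual G) := \row_i generic_quotient.repr (u (pr (X i))).
have liftP (u : pdual G) i : u (pr (X i)) = \pi_QZ (lift u 0 i) by rewrite mxE reprK.
have cE (u v : pdual G) x y := @cok_pairing_coords u v x y fL.
have cC u v : c u v = c v u.
  rewrite /c (cE _ _ _ _ (liftP u) (liftP v)) (cE _ _ _ _ (liftP v) (liftP u)).
  congr (\pi_QZ _); rewrite trmx11 !trmx_mul trmxK mulmxA.
  by rewrite map_trmx laplacian_tr.
have cD (u v w : pdual G) : c (u \+ v) w = c u w + c v w.
  rewrite /c (cE _ _ _ _ (liftP u) (liftP w)) (cE _ _ _ _ (liftP v) (liftP w)).
  rewrite (cE (u \+ v) _ (lift u + lift v) (lift w)) //; last first.
    by move=> i /=; rewrite [in RHS]mxE raddfD /= -!liftP.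
  rewrite -raddfD; congr (\pi_QZ _); rewrite !mulmxDl.
  by rewrite [LHS]mxE.
by split=> // u v w; rewrite cC cD !(cC u).
Qed.

(** Both pairings are biadditive and symmetric, so it is enough to compare them on [eps k], [eps l]
    with k <= l; below the diagonal [qcoef] is 0 and the third clause is void. *)
Lemma good_label_coords : good_label b gr f <->
  [/\ forall y, exists z : Zsum0 n, label_hom f (val z) = y,
      forall j, (\sum_i X i *~ L i j) *m diag_mx (mults N a) = 0 &
      forall p, qcoef N a p * ((coord_sum p)%:~R - (B p)%:R) = 0].
Proof.
have [bC bDl bDr] := hb.
have key (p : 'I_r * 'I_r) : (p.1 <= p.2)%N ->
   (\pi_QZ ((coord_sum p)%:~R / (a p.1 * a p.2)%:R) == b (eps p.1) (eps p.2))
   = (qcoef N a p * ((coord_sum p)%:~R - (B p)%:R) == 0).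
  move=> le; rewrite BE (pmulrn _ (B p)) QZ_divn_eq ?muln_gt0 ?a_gt0 //.
  rewrite /qcoef le mulrC (pmulrn _ (B p)) -intrB Zp_int_eq0 //.
split=> [[hgen fL hp]|[hgen fL hp]].
  split=> //; first exact/label_laplacian_coords.
  case=> k l; apply/eqP; have [kl|lk] := boolP (k <= l)%N.
    by rewrite -key // -(cok_pairing_eps k l fL) hp.
  by rewrite /qcoef /= (negPf lk) mul0r.
have {}fL := label_laplacian_coords.2 fL.
split=> //; have [cC cDl cDr] := cok_pairing_biadditive fL.
apply: biadditive_eq => // k l.
wlog kl : k l / (k <= l)%N => [wl|].
  by have [/wl//|/ltnW/wl h] := leqP k l; rewrite cC bC.
by rewrite (cok_pairing_eps k l fL); apply/eqP; rewrite (key (k, l) kl) hp.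
Qed.

End PairingCoordinates.

(** * The Fourier expansion of the moment *)

Lemma ffun_pairE (n : nat) (T U : finType) (A : nmodType)
    (F : {ffun 'I_n -> T} -> {ffun 'I_n -> U} -> A) :
  \sum_f \sum_h F f h =
  \sum_(v : {ffun 'I_n -> T * U}) F [ffun i => (v i).1] [ffun i => (v i).2].
Proof.
rewrite pair_bigA /= (reindex (fun v : {ffun 'I_n -> T * U} =>
  ([ffun i => (v i).1] : {ffun 'I_n -> T}, [ffun i => (v i).2] : {ffun 'I_n -> U}))) //.
exists (fun p : {ffun 'I_n -> T} * {ffun 'I_n -> U} => [ffun i => (p.1 i, p.2 i)]).
  by move=> v _; apply/ffunP => i; rewrite !ffunE /= -surjective_pairing.
by move=> [f h] _; congr (_, _); apply/ffunP => i; rewrite !ffunE.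
Qed.

(** Since the rows of L sum to 0, [F i i] may be subtracted from the i-th row, which leaves only
    edges. For a bilinear F evaluated at labels, an edge contributes minus the quadratic form at the
    difference of its two labels. *)
Lemma laplacian_sum (A : comNzRingType) n (gr : graph n) (F : 'I_n -> 'I_n -> A) :
  \sum_(i < n) \sum_(j < n) (laplacian gr i j)%:~R * F i j =
  \sum_(i < n) \sum_(j < n | (i < j)%N)
     (if adj gr i j then F i j + F j i - F i i - F j j else 0).
Proof.
pose r i j := if adj gr i j then F i j - F i i else 0.
have adjC i j : adj gr j i = adj gr i j by rewrite /adj setUC.
have -> : \sum_(i < n) \sum_(j < n | (i < j)%N)
     (if adj gr i j then F i j + F j i - F i i - F j j else 0)
   = \sum_(i < n) \sum_(j < n | (i < j)%N) (r i j + r j i).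
  apply: eq_bigr => i _; apply: eq_bigr => j _; rewrite /r adjC.
  by case: ifP => _; [ring|rewrite addr0].
rewrite big_lt_neq; apply: eq_bigr => i _.
have row0 : \sum_(j < n) (laplacian gr i j)%:~R = 0 :> A.
  rewrite -rmorph_sum /= (_ : \sum_j laplacian gr i j = 0) // -[RHS](laplacian_col_sum gr i).
  by apply: eq_bigr => j _; rewrite -[in LHS](laplacian_tr gr) mxE.
have -> : \sum_(j < n) (laplacian gr i j)%:~R * F i j =
    \sum_(j < n) (laplacian gr i j)%:~R * (F i j - F i i).
  under [RHS]eq_bigr => j _ do rewrite mulrBr.
  by rewrite sumrB -mulr_suml row0 mul0r subr0.
rewrite (bigD1 i) //= subrr mulr0 add0r; apply: eq_bigr => j /negPf ji.
by rewrite mxE eq_sym ji /r; case: ifP => _; rewrite ?mul0r ?mul1r.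
Qed.

Lemma quad_pairE (A : comNzRingType) r (u v : 'rV[A]_r) (M : 'M[A]_r) :
  (u *m M *m v^T) 0 0 = \sum_p M p.1 p.2 * (u 0 p.1 * v 0 p.2).
Proof.
rewrite mxE -(pair_bigA _ (fun k l => M k l * (u 0 k * v 0 l))) /= exchange_big /=.
apply: eq_bigr => l _; rewrite !mxE mulr_suml; apply: eq_bigr => k _.
by rewrite mulrCA mulrA.
Qed.

Lemma dpair_sumMz (N r n : nat) (d c : 'rV['Z_N]_r) (X : 'I_n -> 'rV['Z_N]_r) (m : 'I_n -> int) :
  dpair d c (\sum_i X i *~ m i) = \sum_i (m i)%:~R * dpair d c (X i).
Proof.
rewrite (big_morph (dpair d c) (dpairDr d c) (dpair0r d c)); apply: eq_bigr => i _.
by rewrite /dpair -scaler_int linearZ /= -scalemxAr mxE.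
Qed.

Lemma clique_error_complex (R : realType) (rho : R) (v M m n : nat) :
  let rhoC := real_complex R rho in
  real_complex R (clique_error rho v M m n) =
  v%:R ^+ n * rhoC ^+ (m.+1 ^ 2)
   + (1 + (2 ^ v)%:R) *
       ((2 ^ v)%:R * ((v.+1.*2)%:R ^+ (v * m) * (M%:R - 2^-1) ^+ n))
   + (2 ^ v)%:R * ((M%:R + v%:R * rhoC ^+ m.+1) ^+ n - M%:R ^+ n).
Proof.
pose f : {rmorphism R -> R[i]} := real_complex R.
rewrite /clique_error -/f; move: (v.+1.*2)%N (2 ^ v)%N (m.+1 ^ 2)%N => D E k.
by rewrite !(rmorph_nat f, rmorphB f, rmorphD f, rmorphM f, rmorphXn f, rmorph1 f, fmorphV f).
Qed.

(** * Averaging over the graph and over the quadratic forms *)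

Section Assembly.
Variables (R : realType) (q : R).
Hypotheses (q_gt0 : 0 < q) (q_lt1 : q < 1).
Variables (N r : nat) (a : 'I_r -> nat) (G : finZmodType) (g : 'I_r -> G).
Hypothesis N1 : (1 < N)%N.
Hypothesis a_gt0 : forall k, (0 < a k)%N.
Hypothesis aaN : forall k l, (a k * a l %| N)%N.
Hypothesis gens : forall x, exists m : 'I_r -> nat, x = \sum_k g k *+ m k.
Hypothesis rels : forall m : 'I_r -> nat,
  (\sum_k g k *+ m k == 0) = [forall k, (a k %| m k)%N].
Hypothesis prod_a : (\prod_k a k = #|G|)%N.
Variables (b : pdual G -> pdual G -> QZ) (B : 'I_r * 'I_r -> nat).
Hypothesis B1 : forall p, (a p.1 %| B p)%N.
Hypothesis B2 : forall p, (a p.2 %| B p)%N.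

Local Notation V0 := 'rV['Z_N]_r.
Local Notation V := (V0 * V0)%type.
Local Notation pr := (to_groupA N1 aaN rels).
Local Notation d := (mults N a).
Local Notation Qt := {ffun 'I_r * 'I_r -> 'Z_N}.
Local Notation "x %:C" := (real_complex R x).

(** The conclusion of [good_label_coords], assumed here so that the dual basis does not have to be
    carried along. *)
Hypothesis good_coords : forall n (gr : graph n) (X : {ffun 'I_n -> V0}),
  good_label b gr [ffun i => pr (X i)] <->
  [/\ forall y, exists z : Zsum0 n, label_hom [ffun i => pr (X i)] (val z) = y,
      forall j, (\sum_i X i *~ laplacian gr i j) *m diag_mx d = 0 &
      forall p, qcoef N a p * ((coord_sum gr X p)%:~R - (B p)%:R) = 0].

Variable psi : 'Z_N -> R[i].
Hypothesis psiD : forall s t, psi (s + t) = psi s * psi t.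
Hypothesis psi_eq1 : forall t, psi t = 1 -> t = 0.
Hypothesis psi0 : psi 0 = 1.
Hypothesis psi_norm : forall t, `|psi t| = 1.

Definition edge_weight (Q : Qt) (u v : V) : R[i] :=
  q%:C * psi (- qform d (qmat a Q) (u - v)) + (1 - q)%:C.

Lemma psi_sum (I : Type) (s : seq I) (P : pred I) (F : I -> 'Z_N) :
  psi (\sum_(i <- s | P i) F i) = \prod_(i <- s | P i) psi (F i).
Proof. exact: (big_morph psi psiD psi0). Qed.

Lemma psi_laplacian (Q : Qt) n (gr : graph n) (v : {ffun 'I_n -> V}) :
  psi (\sum_i \sum_j (laplacian gr i j)%:~R * bform d (qmat a Q) (v i) (v j)) =
  \prod_(i < n) \prod_(j < n | (i < j)%N)
    (if adj gr i j then psi (- qform d (qmat a Q) (v i - v j)) else 1).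
Proof.
rewrite laplacian_sum psi_sum; apply: eq_bigr => i _.
rewrite psi_sum; apply: eq_bigr => j _; case: ifP => _ //; congr psi.
rewrite qformB /qpolar /qform; set x := bform _ _ _ _; set y := bform _ _ _ _.
by set z := bform _ _ _ _; set t := bform _ _ _ _; ring.
Qed.

Lemma expect_psi (Q : Qt) n (v : {ffun 'I_n -> V}) :
  \sum_(gr : graph n) (Gnq_prob q gr)%:C *
     psi (\sum_i \sum_j (laplacian gr i j)%:~R * bform d (qmat a Q) (v i) (v j))
  = weight (edge_weight Q) v.
Proof.
under eq_bigr => gr _ do rewrite psi_laplacian.
exact: (Gnq_expect_prod q (fun i j => psi (- qform d (qmat a Q) (v i - v j)))).
Qed.

Lemma sum_psi_vec (y : V0) :
  \sum_(c : V0) psi (- dpair d c y) = #|V0|%:R * (y *m diag_mx d == 0)%:R.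
Proof.
have VT : zmod_closed [set: V0] by split=> [|? ? ? ?]; rewrite inE.
have := psi_dpair_sum psiD psi_eq1 psi0 d (- y) VT.
rewrite perp_setT inE mulNmx oppr_eq0 cardsT => h.
transitivity (\sum_(c in [set: V0]) psi (dpair d (- y) c)).
  apply: eq_big => [c|c _]; rewrite ?inE //; congr psi.
  by rewrite (dpairC d (- y)) dpairNr.
by rewrite h; case: eqP; rewrite ?mulr1 ?mulr0.
Qed.

Lemma sum_psi_scal (e y : 'Z_N) :
  \sum_(t : 'Z_N) psi (t * e * y) = N%:R * (e * y == 0)%:R.
Proof.
have VT : zmod_closed [set: 'Z_N] by split=> [|? ? ? ?]; rewrite inE.
rewrite (eq_bigl (mem [set: 'Z_N])) => [|t]; last by rewrite /= inE.
rewrite (char_sum VT) => [|s t _ _|]; last by rewrite !mul0r psi0.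
  have -> : #|[set: 'Z_N]| = N by rewrite cardsT card_ord Zp_cast.
  case: (eqVneq (e * y) 0) => [ey|ey].
    rewrite (_ : [forall x in _, _]) ?mulr1 //; apply/forall_inP => t _.
    by rewrite -mulrA ey mulr0 psi0.
  rewrite mulr0 ifF //; apply/negP => /forall_inP/(_ 1); rewrite inE => /(_ isT)/eqP/psi_eq1.
  by rewrite mul1r => /eqP; rewrite (negPf ey).
by rewrite !mulrDl psiD.
Qed.

(** For fixed X the exponent is additive in c and Q: [c j] is paired with the j-th column of X L,
    and [Q p] multiplies [qcoef p] times the defect of the p-th pairing congruence. The sum splits
    into one full character sum for each vertex and one for each p. *)
Lemma sum_psi_conditions n (gr : graph n) (X : {ffun 'I_n -> V0}) :
  \sum_(c : {ffun 'I_n -> V0}) \sum_(Q : Qt)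
    psi (- \sum_p qmat a Q p.1 p.2 * (B p)%:R) *
    psi (\sum_i \sum_j (laplacian gr i j)%:~R *
           bform d (qmat a Q) (X i, c i) (X j, c j))
  = #|V0|%:R ^+ n * N%:R ^+ (r * r) *
    ([forall j, (\sum_i X i *~ laplacian gr i j) *m diag_mx d == 0] &&
     [forall p, qcoef N a p * ((coord_sum gr X p)%:~R - (B p)%:R) == 0])%:R.
Proof.
pose y j := \sum_i X i *~ laplacian gr i j.
pose t p : 'Z_N := (coord_sum gr X p)%:~R - (B p)%:R.
have E (c : {ffun 'I_n -> V0}) (Q : Qt) :
    psi (- \sum_p qmat a Q p.1 p.2 * (B p)%:R) *
    psi (\sum_i \sum_j (laplacian gr i j)%:~R *
           bform d (qmat a Q) (X i, c i) (X j, c j))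
    = (\prod_j psi (- dpair d (c j) (y j))) * \prod_p psi (Q p * qcoef N a p * t p).
  rewrite -!psi_sum -!psiD; congr psi.
  have -> : \sum_i \sum_j (laplacian gr i j)%:~R * bform d (qmat a Q) (X i, c i) (X j, c j)
    = \sum_p qmat a Q p.1 p.2 * (coord_sum gr X p)%:~R - \sum_j dpair d (c j) (y j).
    under eq_bigr => i _ do under eq_bigr => j _ do rewrite mulrBr.
    under eq_bigr => i _ do rewrite sumrB.
    rewrite sumrB; congr (_ - _).
      under eq_bigr => i _ do under eq_bigr => j _ do rewrite quad_pairE mulr_sumr.
      under eq_bigr => i _ do rewrite exchange_big.
      rewrite exchange_big /=; apply: eq_bigr => p _.
      rewrite /coord_sum rmorph_sum mulr_sumr; apply: eq_bigr => i _.
      rewrite rmorph_sum mulr_sumr; apply: eq_bigr => j _.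
      by rewrite !rmorphM /= -!pmulrn !natr_Zp; ring.
    rewrite exchange_big /=; apply: eq_bigr => j _.
    by rewrite dpair_sumMz.
  rewrite sumrN [LHS]addrA [RHS]addrC; congr (_ - _).
  rewrite addrC -sumrB; apply: eq_bigr => p _; rewrite mxE -surjective_pairing.
  by rewrite -mulrBr.
under eq_bigr => c _ do under eq_bigr => Q _ do rewrite E.
under eq_bigr => c _ do rewrite -mulr_sumr.
rewrite -mulr_suml.
have -> : \sum_(c : {ffun 'I_n -> V0}) \prod_j psi (- dpair d (c j) (y j))
   = #|V0|%:R ^+ n * [forall j, y j *m diag_mx d == 0]%:R.
  rewrite -(bigA_distr_bigA (fun j c => psi (- dpair d c (y j)))) /=.
  under eq_bigr => j _ do rewrite sum_psi_vec.
  rewrite big_split /= prodr_const card_ord; congr (_ * _).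
  case: forallP => [h|/forallP]; first by rewrite big1 // => j _; rewrite h.
  by rewrite negb_forall => /existsP[j /negPf yj]; rewrite (bigD1 j) //= yj mul0r.
have -> : \sum_(Q : Qt) \prod_p psi (Q p * qcoef N a p * t p)
   = N%:R ^+ (r * r) * [forall p, qcoef N a p * t p == 0]%:R.
  rewrite -(bigA_distr_bigA (fun p s => psi (s * qcoef N a p * t p))) /=.
  under eq_bigr => p _ do rewrite sum_psi_scal.
  rewrite big_split /= prodr_const card_prod card_ord; congr (_ * _).
  case: forallP => [h|/forallP]; first by rewrite big1 // => p _; rewrite h.
  by rewrite negb_forall => /existsP[p /negPf tp]; rewrite (bigD1 p) //= tp mul0r.
rewrite mulrACA; congr (_ * _).
by case: [forall j, _]; case: [forall p, _]; rewrite ?mulr1 ?mulr0.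
Qed.

Definition labels_generate n (X : {ffun 'I_n -> V0}) : bool :=
  `[< forall y, exists z : Zsum0 n, label_hom [ffun i => pr (X i)] (val z) = y >].

(** On a vector of coordinate sum 0 the labelling may be replaced by the differences [f i - f 0];
    conversely each difference of labels is the value at some e_k - e_l. *)
Lemma generating_labels n (v : {ffun 'I_n.+1 -> V}) :
  generating pr (image_of v) = labels_generate [ffun i => (v i).1].
Proof.
set f : {ffun 'I_n.+1 -> G} := [ffun i => pr ([ffun i => (v i).1] i)].
have fE i : f i = pr (v i).1 by rewrite !ffunE.
apply: asbool_equiv_eq; split=> [h y|h A Az hA].
  have /setP/(_ y) : [set y | `[< exists z : Zsum0 n.+1, label_hom f (val z) = y >]] = [set: G].
    apply: h => [|t t' /imsetP[k _ ->] /imsetP[l _ ->]].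
      split=> [|y1 y2]; rewrite !inE; first by apply/asboolP; exists 0; rewrite !raddf0.
      move=> /asboolP[z1 <-] /asboolP[z2 <-]; apply/asboolP; exists (z1 - z2).
      by rewrite !raddfB.
    rewrite inE; apply/asboolP; exists (MkZsum0 (Zsum0_gen k l)).
    by rewrite /= raddfB /= !label_hom_delta !fE.
  by rewrite !inE => /asboolP.
apply/setP => y; rewrite inE; have [z <-] := h y.
have -> : label_hom f (val z) = \sum_i (f i - f 0) *~ val z i 0.
  under eq_bigr => i _ do rewrite mulrzBl.
  by rewrite sumrB -mulrz_sumr; have /eqP -> := valP z; rewrite mulr0z subr0.
elim/big_rec: _ => [|i x _ xA]; first by case: Az.
apply: zmod_closedD => //; have fA : f i - f 0 \in A.
  by rewrite !fE; apply: hA; apply: imset_f.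
case: (val z i 0) => m; first exact: zmod_closedMn.
rewrite NegzE mulrNz -[- _]sub0r; apply: Az.2; first exact: Az.1.
exact: zmod_closedMn.
Qed.

Lemma card_good_lift n (gr : graph n) :
  (#|[set f | `[< good_label b gr f >]]| * #|rad d| ^ n =
   #|[set X : {ffun 'I_n -> V0} | `[< good_label b gr [ffun i => pr (X i)] >]]|)%N.
Proof.
rewrite -[RHS]sum1_card (partition_big (fun X : {ffun 'I_n -> V0} => [ffun i => pr (X i)])
  (mem [set f | `[< good_label b gr f >]])) /=; last by move=> X; rewrite !inE.
rewrite -sum_nat_const; apply: eq_bigr => f; rewrite inE => gf; rewrite sum1_card.
rewrite (@eq_card _ _ (mem (family (fun i => mem [set x | pr x == f i])))); last first.
  move=> X; apply/idP/familyP => [|h].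
    by rewrite unfold_in /= => /andP[_ /eqP <-] i; rewrite inE ffunE.
  have fE : [ffun i => pr (X i)] = f.
    by apply/ffunP => i; have := h i; rewrite inE ffunE => /eqP.
  by rewrite unfold_in /= inE fE eqxx gf.
rewrite card_family foldrE big_image /= -[n in LHS]card_ord -prod_nat_const.
apply: eq_bigr => i _; rewrite (@card_fiber _ _ pr (f i) (to_group_surj N1 aaN gens rels (f i))).
by apply: eq_card => x; rewrite !inE -(to_group_ker N1 aaN rels).
Qed.

(** * Main term and error of the expected count *)

Local Notation qsgn Q := (psi (- \sum_p qmat a Q p.1 p.2 * (B p)%:R)).
Local Notation M := (clique_bound d).

Definition expect_good n : R :=
  \sum_(gr : graph n) Gnq_prob q gr * #|[set f | `[< good_label b gr f >]]|%:R.

(** The normalisation collects #|V0| per vertex from the sum over c, #|rad d| per vertex from the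
    lifts of a label to V0, and N for each of the r * r coefficients of Q. *)
Lemma expect_good_fourier n :
  (expect_good n.+1)%:C * (M%:R ^+ n.+1 * N%:R ^+ (r * r)) =
  \sum_(Q : Qt) qsgn Q * \sum_(v : {ffun 'I_n.+1 -> V})
     (generating pr (image_of v))%:R * weight (edge_weight Q) v.
Proof.
pose S (gr : graph n.+1) (X c : {ffun 'I_n.+1 -> V0}) : R[i] := \sum_(Q : Qt) qsgn Q *
  psi (\sum_i \sum_j (laplacian gr i j)%:~R * bform d (qmat a Q) (X i, c i) (X j, c j)).
transitivity (\sum_(gr : graph n.+1) (Gnq_prob q gr)%:C * \sum_(X : {ffun 'I_n.+1 -> V0})
   \sum_(c : {ffun 'I_n.+1 -> V0}) (labels_generate X)%:R * S gr X c); last first.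
  under [RHS]eq_bigr => Q _ do rewrite mulr_sumr.
  rewrite [RHS]exchange_big /=.
  under [LHS]eq_bigr => gr _ do rewrite ffun_pairE mulr_sumr.
  rewrite [LHS]exchange_big /=; apply: eq_bigr => v _; rewrite -generating_labels.
  under [RHS]eq_bigr => Q _ do rewrite mulrCA -expect_psi mulr_sumr.
  rewrite -mulr_sumr [in RHS]exchange_big /= mulr_sumr; apply: eq_bigr => gr _.
  rewrite mulrCA; congr (_ * _); rewrite mulr_sumr; apply: eq_bigr => Q _.
  rewrite mulrCA; congr (_ * (_ * psi _)); apply: eq_bigr => i _; apply: eq_bigr => j _.
  by rewrite !ffunE -!surjective_pairing.
rewrite /expect_good rmorph_sum mulr_suml; apply: eq_bigr => gr _.
rewrite rmorphM /= -mulrA; congr (_ * _); rewrite rmorph_nat.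
under eq_bigr => X _ do rewrite -mulr_sumr sum_psi_conditions mulrCA -natrM mulnb.
rewrite -mulr_sumr -natr_sum -!natrX -!natrM; congr (_%:R).
set c := (\sum_X _)%N.
have -> : c = (#|[set f | `[< good_label b gr f >]]| * #|rad d| ^ n.+1)%N.
  rewrite card_good_lift -sum1_card big_mkcond; apply: eq_bigr => X _; rewrite inE.
  have -> : `[< good_label b gr [ffun i => pr (X i)] >] =
     labels_generate X && ([forall j, (\sum_i X i *~ laplacian gr i j) *m diag_mx d == 0] &&
     [forall p, qcoef N a p * ((coord_sum gr X p)%:~R - (B p)%:R) == 0]).
    apply/asboolP/and3P => [/good_coords[h1 h2 h3]|[/asboolP h1 /forallP h2 /forallP h3]].
      by split; [exact/asboolP|apply/forallP => j; rewrite h2|apply/forallP => p; rewrite h3].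
    by apply/good_coords; split=> // [j|p]; apply/eqP.
  by case: (_ && _).
rewrite /clique_bound expnMn.
have AC (x y z t : nat) : (t * (x * y * z) = x * z * (t * y))%N by lia.
exact: AC.
Qed.

(** The main term, equal to the normalising factor N ^ (r * r): the expected number of good
    labellings tends to 1. The equality rests on #|G| * #|qker| = #|rad| ^ r, where the r + 1
    factors #|G| lost in [qker] balance the r lost in [radM] and the one in #|V0| / #|rad|. *)
Lemma sum_qsgn_qtop : \sum_(Q : Qt) qsgn Q * #|qtop d pr (qmat a Q)|%:R = N%:R ^+ (r * r).
Proof.
have mB (k : 'I_r) m : (a k %| m)%N -> d 0 k * m%:R = 0.
  by move=> km; apply/eqP; rewrite mxE mulrC Zp_divn_eq0 ?(aN aaN).
have sol := sum_psi_qsol N1 a_gt0 aaN psi0 (fun p => mB _ _ (B1 p)) (fun p => mB _ _ (B2 p)).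
have rad_gt0 : (0 < #|rad d|)%N by apply/card_gt0P; exists 0; case: (rad_zmod_closed d).
have G_gt0 : (0 < #|G|)%N by apply/card_gt0P; exists 0.
have radG := card_rad N1 aaN gens rels.
have V0E : #|V0| = (#|rad d| * #|G|)%N by rewrite radG card_mx card_ord mul1n Zp_cast.
have kerE : (#|G| * #|qker N a| = #|rad d| ^ r)%N.
  have Gr : (0 < #|G| ^ r)%N by rewrite expn_gt0 G_gt0.
  apply/eqP; rewrite -(eqn_pmul2l Gr) mulnA -expnSr mulnC -prod_a card_qker // prod_a.
  by rewrite -expnMn mulnC radG -expnM.
have cE : (#|rad d| * #|radM d|)%:R != 0 :> R[i].
  by rewrite pnatr_eq0 -lt0n card_radM muln_gt0 expn_gt0 rad_gt0.
apply: (mulIf cE); rewrite mulr_suml.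
transitivity (\sum_(Q : Qt) #|V0|%:R * (qsgn Q * #|qsol d (qmat a Q)|%:R)).
  apply: eq_bigr => Q _; rewrite -mulrA -natrM mulnA.
  rewrite (qtop_qsol psiD psi_eq1 psi0 (to_group_ker N1 aaN rels) (to_group_surj N1 aaN gens rels)).
  by rewrite natrM mulrCA.
rewrite -mulr_sumr sol natrM mulrCA natrX; congr (_ * _).
by rewrite -natrM V0E card_radM -mulnA kerE.
Qed.

(** An edge weight depends only on one element of Z/N, so rho is a maximum over finitely many
    values, each below 1. It serves all Q at once. *)
Lemma edge_weight_bound : exists rho : R, [/\ 0 <= rho, rho < 1 &
  forall Q u v, ~~ qok d (qmat a Q) u v -> `|edge_weight Q u v| <= rho%:C].
Proof.
have H (s : seq 'Z_N) : exists rho : R, [/\ 0 <= rho, rho < 1 &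
    forall t, t \in s -> t != 0 -> `|q%:C * psi t + (1 - q)%:C| <= rho%:C].
  elim: s => [|t s [rho [rho0 rho1 rhoP]]]; first by exists 0.
  have [t0|t0] := eqVneq t 0.
    exists rho; split=> // u; rewrite inE => /predU1P[->|us]; last exact: rhoP.
    by rewrite t0 eqxx.
  pose x := complex.Re `|q%:C * psi t + (1 - q)%:C|.
  have xE : x%:C = `|q%:C * psi t + (1 - q)%:C| by rewrite RRe_real // normr_real.
  have x1 : x < 1.
    rewrite -ltcR xE; apply: norm_convex_lt1 => //.
    by apply: contra_neq t0 => /psi_eq1.
  exists (Num.max rho x); split; first by rewrite le_max rho0.
    by rewrite gt_max rho1.
  move=> u; rewrite inE => /predU1P[->|us] u0; first by rewrite -xE lecR le_max lexx orbT.
  by apply: le_trans (rhoP u us u0) _; rewrite lecR le_max lexx.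
have [rho [rho0 rho1 rhoP]] := H (enum 'Z_N).
exists rho; split=> // Q u v nok; apply: rhoP; first by rewrite mem_enum.
by rewrite oppr_eq0.
Qed.

Lemma expect_good_exp_small : exp_small (fun n => `|expect_good n - 1|).
Proof.
have [rho [rho0 rho1 rhoP]] := edge_weight_bound.
have V0pos : (0 < #|V0|)%N by apply/card_gt0P; exists 0.
have rad_gt0 : (0 < #|rad d|)%N by apply/card_gt0P; exists 0; case: (rad_zmod_closed d).
have M0 : (0 < M)%N by rewrite muln_gt0 V0pos.
have [m [t [K [t0 t1 K0 h]]]] := clique_error_exp_small #|{: V}| rho0 rho1 M0.
apply: (exp_small_eventually (n0 := 1)); exists t, K; split=> // -[//|n] _.
apply: le_trans (h n.+1).
have Mn : 0 < M%:R ^+ n.+1 :> R by rewrite exprn_gt0 // ltr0n.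
rewrite ler_pdivlMr //.
have Nr : 0 < N%:R ^+ (r * r) :> R by rewrite exprn_gt0 // ltr0n ltnW.
rewrite -(ler_pM2r Nr) -lecR.
have -> : (`|expect_good n.+1 - 1| * M%:R ^+ n.+1 * N%:R ^+ (r * r))%:C =
  `|\sum_(Q : Qt) qsgn Q * (\sum_(v : {ffun 'I_n.+1 -> V})
     (generating pr (image_of v))%:R * weight (edge_weight Q) v
     - #|qtop d pr (qmat a Q)|%:R * M%:R ^+ n.+1)|.
  under eq_bigr => Q _ do rewrite mulrBr mulrA.
  rewrite sumrB -mulr_suml sum_qsgn_qtop -expect_good_fourier.
  rewrite -[N%:R ^+ _ * _]mul1r [X in _ - 1 * X]mulrC -mulrBl normrM.
  rewrite -mulrA rmorphM /=; congr (_ * _).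
    by rewrite -(rmorph1 (real_complex R)) -rmorphB /= normc_def /= expr0n addr0 sqrtr_sqr.
  by rewrite ger0_norm ?mulr_ge0 ?exprn_ge0 // rmorphM !rmorphXn /= !rmorph_nat.
(* The number of Q equals the normalising factor, so summing the clique error over Q costs
   nothing. *)
have cardQ : #|{: Qt}| = (N ^ (r * r))%N by rewrite card_ffun card_prod !card_ord Zp_cast.
apply: le_trans (ler_norm_sum _ _ _) _.
apply: (@le_trans _ _ (\sum_(Q : Qt) (clique_error rho #|{: V}| M (m n.+1) n.+1)%:C)); last first.
  by rewrite sumr_const cardQ -natrX -[leLHS]mulr_natr rmorphM /= rmorph_nat.
apply: ler_sum => Q _; rewrite normrM psi_norm mul1r.
have rho0C : 0 <= rho%:C by rewrite ler0c.
have rho1C : rho%:C <= 1 by rewrite -(rmorph1 (real_complex R)) lecR ltW.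
have wok u v : qok d (qmat a Q) u v -> edge_weight Q u v = 1.
  rewrite /edge_weight => /eqP ->; rewrite oppr0 psi0 mulr1 -rmorphD /=.
  by rewrite addrC subrK.
have cliq := qclique_le psiD psi_eq1 psi0 (d := d) (QQ := qmat a Q).
have := top_clique_sum (qok_sym d (qmat a Q)) (qok_refl d (qmat a Q)) rho0C rho1C wok
  (rhoP Q) (generating pr) cliq (m n.+1) n.+1 M0.
move=> /le_trans; apply.
by rewrite clique_error_complex.
Qed.

End Assembly.

Theorem theorem8p2 (R : realType) (q : R) (hq0 : 0 < q) (hq1 : q < 1)
    (G : finZmodType) (b : pdual G -> pdual G -> QZ) (hb : symmetric_pairing b) :
  exists c K : R, [/\ 0 < c, 0 < K &
    forall n : nat,
      `| Gnq_expect q (fun g : graph n => #|` fset_set (Sur_star b g)|%:R)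
         - #|G|%:R^-1 | <= K * expR (- c * n%:R)].
Proof.
apply: exp_small_expR.
have [r [g [a [a_gt0 aG gens rels prod_a]]]] := finZmod_structure G.
have G_gt0 : (0 < #|G|)%N by apply/card_gt0P; exists 0.
(* The factor 2 only ensures 1 < N: 'Z_1 is Z/2. *)
pose N := (2 * (#|G| * #|G|))%N.
have N1 : (1 < N)%N by rewrite (@leq_mul 2 1) // muln_gt0 G_gt0.
have aaN k l : (a k * a l %| N)%N by rewrite dvdn_mull // dvdn_mul.
have [eps epsE] := choice (coord_char_exists N1 a_gt0 aaN gens rels).
have [B BP] := pairing_coords a_gt0 gens epsE hb.
have BE p : b (eps p.1) (eps p.2) = \pi_QZ ((B p)%:R / (a p.1 * a p.2)%:R) by have [] := BP p.
have B1 p : (a p.1 %| B p)%N by have [] := BP p.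
have B2 p : (a p.2 %| B p)%N by have [] := BP p.
(* [(Zp_trunc N).+2] is the modulus as it occurs in the type 'Z_N; it equals N because 1 < N. *)
have [z zP] := prim_root_exists R[i] (ltn0Sn (Zp_trunc N).+1).
pose psi (t : 'Z_N) : R[i] := z ^+ t.
have psiD s t : psi (s + t) = psi s * psi t.
  by rewrite /psi -exprD /= (prim_expr_mod zP).
have psi_eq1 t : psi t = 1 -> t = 0.
  move=> /eqP; rewrite -(prim_order_dvd zP) => dv; apply/val_inj => /=.
  by apply/eqP; move: dv; rewrite /dvdn modn_small.
have psi_norm t : `|psi t| = 1.
  have /eqP : `|z| ^+ (Zp_trunc N).+2 = 1 by rewrite -normrX (prim_expr_order zP) normr1.
  by rewrite pexpr_eq1 // /psi normrX => /eqP ->; rewrite expr1n.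
have coords n (gr : graph n) X :=
  good_label_coords a_gt0 gens epsE hb BE gr X.
have [t [K [t0 t1 K0 h]]] := expect_good_exp_small hq0 hq1 a_gt0 gens prod_a B1 B2
  coords psiD psi_eq1 (expr0 z) psi_norm.
(* The empty graph has no base vertex for the passage to labellings; the term n = 0 is absorbed by
   the constant. *)
apply: (exp_small_eventually (n0 := 1)); exists t, K; split=> // -[//|n] _.
apply: le_trans (h n.+1).
have G1 : 1 <= #|G|%:R :> R by rewrite ler1n.
have -> : Gnq_expect q (fun gr : graph n.+1 => #|` fset_set (Sur_star b gr)|%:R)
    = expect_good q b n.+1 / #|G|%:R.
  rewrite /expect_good mulr_suml; apply: eq_bigr => gr _.
  by rewrite -mulrA -card_Sur_star natrM mulfK // pnatr_eq0 -lt0n.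
rewrite -[X in _ - X]mul1r -mulrBl normrM ler_piMr // ger0_norm ?invr_ge0 //.
by rewrite invf_le1 // (lt_le_trans ltr01).
Qed.
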